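(* Let $K$ be an algebraically closed field of characteristic zero, $l\in\mathbb{N}$, let $m,n\in\mathbb{N}$ be coprime with $m,n>1$, and let $P,Q\in L^{(l)}$ with $$[P,Q]\in K^\times\quad\text{and}\quad \frac{v_{1,1}(P)}{v_{1,1}(Q)}=\frac{v_{1,0}(P)}{v_{1,0}(Q)}=\frac mn .$$ Assume that $(\rho_0,\sigma_0)\in\mathfrak{V}_{\ge0}$ satisfies: (1) $(\rho_0,\sigma_0)\in\mathrm{Dir}(P)$ and $v_{\rho_0,\sigma_0}(P)>0$; (2) $\frac1m\mathrm{en}_{\rho_0,\sigma_0}(P)=\frac1n\mathrm{en}_{\rho_0,\sigma_0}(Q)\in\frac1l\mathbb{Z}\times\mathbb{N}$; (3) $b>a/l$, where $(a/l,b):=\frac1m\mathrm{en}_{\rho_0,\sigma_0}(P)$. Let $I_0:=[(\rho_0,\sigma_0),(0,-1)[$ and $$(\tilde\rho,\tilde\sigma):=\max\{(\rho,\sigma)\in\mathrm{Dir}(P)\cap I_0: v_{\rho',\sigma'}(P)>0\text{ for all }(\rho_0,\sigma_0)\le(\rho',\sigma')\le(\rho,\sigma)\}.$$ Let $F\in L^{(l)}$ be a $(\rho_0,\sigma_0)$-homogeneous element and $G_0\in K[P,Q]\setminus\{0\}$ such that $$v_{\rho_0,\sigma_0}(F)=\rho_0+\sigma_0,\quad [F,\ell_{\rho_0,\sigma_0}(P)]=\ell_{\rho_0,\sigma_0}(P),\quad [\ell_{\rho_0,\sigma_0}(G_0),\ell_{\rho_0,\sigma_0}(P)]\,F=\ell_{\rho_0,\sigma_0}(G_0)\,\ell_{\rho_0,\sigma_0}(P),$$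 and such that, setting recursively $G_i:=[G_{i-1},P]$, one has $[\ell_{\rho_0,\sigma_0}(G_i),\ell_{\rho_0,\sigma_0}(P)]=0$ for all $i\ge1$. If there exist coprime $p,q\in\mathbb{N}$ such that $\mathrm{en}_{\rho_0,\sigma_0}(F)=\frac pq(a/l,b)$, then for all $(\rho,\sigma)\in\mathfrak{V}$ with $(\rho_0,\sigma_0)<(\rho,\sigma)\le(\tilde\rho,\tilde\sigma)$ there exists a $(\rho,\sigma)$-homogeneous element $R\in L^{(l)}$ such that $\ell_{\rho,\sigma}(P)=R^{qm}$.
   Context: $\mathbb{N}$ is the set of positive integers. $L^{(l)}=K[x^{1/l},x^{-1/l},y]$, and $[P,Q]:=\partial_xP\,\partial_yQ-\partial_xQ\,\partial_yP$ for $P,Q\in L^{(l)}$. $K[P,Q]$ is the $K$-subalgebra generated by $P,Q$. Directions: $\mathfrak{V}=\{(\rho,\sigma)\in\mathbb{Z}^2:\gcd(\rho,\sigma)=1\}$, $\mathfrak{V}_{\ge0}=\{(\rho,\sigma)\in\mathfrak{V}:\rho+\sigma\ge0\}$. Identifying a direction with its unit vector in $S^1$, an interval in $\mathfrak{V}$ is the preimage of an arc that is not the whole circle, ordered increasingly counterclockwise; $[A,B[$ is the arc going counterclockwise from $A$ (included) to $B$ (excluded), and the inequalities in the claim refer to the order of $I_0$. For $(\rho,\sigma)\in\mathfrak{V}$ and $P=\sum a_{i/l,j}x^{i/l}y^j\ne0$: $\mathrm{Supp}(P)=\{(i/l,j):a_{i/l,j}\neq0\}$, $v_{\rho,\sigma}(i/l,j)=\rho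 i/l+\sigma j$, $v_{\rho,\sigma}(P)=\max v_{\rho,\sigma}$ over $\mathrm{Supp}(P)$, and $\ell_{\rho,\sigma}(P)$ is the sum of the terms of $P$ attaining this maximum; $v_{\rho,\sigma}(0)=-\infty$, $\ell_{\rho,\sigma}(0)=0$. $P$ is $(\rho,\sigma)$-homogeneous if $P=\ell_{\rho,\sigma}(P)$. $\mathrm{Dir}(P)=\{(\rho,\sigma)\in\mathfrak{V}:\#\mathrm{Supp}(\ell_{\rho,\sigma}(P))>1\}$. With $(a_1,a_2)\times(b_1,b_2)=a_1b_2-a_2b_1$: if $\ell_{\rho,\sigma}(P)$ is a monomial, $\mathrm{st}_{\rho,\sigma}(P)=\mathrm{en}_{\rho,\sigma}(P)$ is its exponent; otherwise they are the two endpoints of the segment spanned by $\mathrm{Supp}(\ell_{\rho,\sigma}(P))$, ordered so that $(\rho,\sigma)\times(\mathrm{en}_{\rho,\sigma}(P)-\mathrm{st}_{\rho,\sigma}(P))>0$. *)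

(* Defs.v *)
(* The algebra L = K[x^(1/l), x^(-1/l), y], its directions, valuations and
   leading forms. *)
From HB Require Import structures.
From mathcomp Require Import all_boot all_order all_algebra.
From mathcomp Require Import finmap.
From mathcomp Require Import monalg.
From mathcomp Require Import constructive_ereal.

Set Implicit Arguments.
Unset Strict Implicit.
Unset Printing Implicit Defensive.

Import Order.TTheory GRing.Theory Num.Theory.
Local Open Scope fset_scope.
Local Open Scope ring_scope.

(* The pair (i, j) stands for the monomial x^(i/l) y^j.  The library makes
   {malg K[M]} a ring only when M has no nontrivial units, which excludes
   negative exponents, so the convolution product is introduced here. *)
Definition laurent (K : fieldType) (l : nat) : Type :=
  {malg K[(int * nat)%type]}.

Section LaurentRing.
Variables (K : fieldType) (l : nat).
Local Notation L := (laurent K l).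

HB.instance Definition _ := GRing.Lmodule.on L.

Implicit Types (P Q : L) (e f : int * nat) (a b c : K).

Definition monomial c e : L := << c *g e >>.

Definition expD e f : int * nat := (e.1 + f.1, (e.2 + f.2)%N).

Definition lone : L := monomial 1 (0, 0%N).

Definition lmul P Q : L :=
  \sum_(e <- msupp P) \sum_(f <- msupp Q) monomial (P@_e * Q@_f) (expD e f).

Lemma monomial0 e : monomial 0 e = 0.
Proof. exact: monalgU0. Qed.

Lemma monomialD a b e : monomial (a + b) e = monomial a e + monomial b e.
Proof. exact: monalgUD. Qed.

Lemma monomialZ c a e : c *: monomial a e = monomial (c * a) e.
Proof.
apply/malgP=> k; rewrite /monomial mcoeffZ !mcoeffU.
by case: eqP => //= _; rewrite ?mulr1n ?mulr0n ?mulr0.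
Qed.

Lemma laurentE P : P = \sum_(e <- msupp P) monomial P@_e e.
Proof. exact: monalgE. Qed.

Lemma expDA : associative expD.
Proof. by move=> e f g; rewrite /expD /= addrA addnA. Qed.

Lemma expDC : commutative expD.
Proof. by move=> e f; rewrite /expD addrC addnC. Qed.

Lemma exp0D e : expD (0, 0%N) e = e.
Proof. by case: e => i j; rewrite /expD /= add0r add0n. Qed.

Lemma lmulw (d1 d2 : {fset int * nat}) P Q :
  msupp P `<=` d1 -> msupp Q `<=` d2 ->
  lmul P Q = \sum_(e <- d1) \sum_(f <- d2) monomial (P@_e * Q@_f) (expD e f).
Proof.
move=> le1 le2; rewrite /lmul (big_fset_incl _ le1) /=.
  apply: eq_bigr => e _; apply: big_fset_incl => // f _ /mcoeff_outdom ->.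
  by rewrite mulr0 monomial0.
move=> e _ /mcoeff_outdom Pe.
by rewrite big1 // => f _; rewrite Pe mul0r monomial0.
Qed.

Lemma lmulC : commutative lmul.
Proof.
move=> P Q; rewrite /lmul exchange_big.
by apply: eq_bigr => e _; apply: eq_bigr => f _; rewrite mulrC expDC.
Qed.

Lemma lmulDl : left_distributive lmul +%R.
Proof.
move=> P1 P2 Q; set d := msupp P1 `|` msupp P2.
have s1 : msupp P1 `<=` d := fsubsetUl _ _.
have s2 : msupp P2 `<=` d := fsubsetUr _ _.
have s3 : msupp (P1 + P2) `<=` d by exact: msuppD_le.
rewrite (lmulw s1 (fsubset_refl _)) (lmulw s2 (fsubset_refl _)).
rewrite (lmulw s3 (fsubset_refl _)) -big_split /=; apply: eq_bigr => e _.
rewrite -big_split /=; apply: eq_bigr => f _.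
by rewrite mcoeffD mulrDl monomialD.
Qed.

Lemma lmul0l Q : lmul 0 Q = 0.
Proof. by rewrite /lmul msupp0 big_seq_fset0. Qed.

Lemma lmul_suml (I : Type) (r : seq I) (F : I -> L) Q :
  lmul (\sum_(i <- r) F i) Q = \sum_(i <- r) lmul (F i) Q.
Proof.
exact: (big_morph (lmul^~ Q) (fun P1 P2 => lmulDl P1 P2 Q) (lmul0l Q)).
Qed.

Lemma lmul_sumr (I : Type) (r : seq I) (F : I -> L) P :
  lmul P (\sum_(i <- r) F i) = \sum_(i <- r) lmul P (F i).
Proof. by rewrite lmulC lmul_suml; apply: eq_bigr => i _; rewrite lmulC. Qed.

Lemma lmulUU a b e f :
  lmul (monomial a e) (monomial b f) = monomial (a * b) (expD e f).
Proof. by rewrite (lmulw msuppU_le msuppU_le) !big_seq_fset1 !mcoeffUU. Qed.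

Lemma lmulA : associative lmul.
Proof.
move=> P Q R; rewrite (laurentE P) !lmul_suml; apply: eq_bigr => e _.
rewrite (laurentE Q) lmul_suml !lmul_sumr lmul_suml; apply: eq_bigr => f _.
rewrite (laurentE R) !lmul_sumr; apply: eq_bigr => g _.
by rewrite !lmulUU mulrA expDA.
Qed.

Lemma lmul1l : left_id lone lmul.
Proof.
move=> P; rewrite [P in lmul _ P]laurentE lmul_sumr [RHS]laurentE.
by apply: eq_bigr => e _; rewrite lmulUU mul1r exp0D.
Qed.

Lemma lone_neq0 : lone != 0.
Proof. by rewrite monalgU_eq0 oner_eq0. Qed.

HB.instance Definition _ := GRing.Zmodule_isComNzRing.Build L
  lmulA lmulC lmul1l lmulDl lone_neq0.

Lemma lscaleAl c P Q : c *: (P * Q) = (c *: P) * Q.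
Proof.
have ZE R : c *: R = lmul (monomial c (0, 0%N)) R.
  rewrite (laurentE R) lmul_sumr scaler_sumr.
  by apply: eq_bigr => e _; rewrite lmulUU monomialZ exp0D.
by rewrite !ZE; exact: lmulA.
Qed.

HB.instance Definition _ := GRing.Lmodule_isLalgebra.Build K L lscaleAl.
HB.instance Definition _ := GRing.Lalgebra_isComAlgebra.Build K L.

End LaurentRing.

Section Bracket.
Variables (K : fieldType) (l : nat).
Local Notation L := (laurent K l).
Implicit Types P Q : L.

Definition dx P : L :=
  \sum_(e <- msupp P)
    monomial l (e.1%:~R / l%:R * P@_e) (e.1 - l%:Z, e.2).

(* For e.2 = 0 the coefficient vanishes, so the truncated e.2.-1 is harmless. *)
Definition dy P : L :=
  \sum_(e <- msupp P) monomial l (e.2%:R * P@_e) (e.1, e.2.-1).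

Definition bracket P Q : L := dx P * dy Q - dx Q * dy P.

(* The K-subalgebra K[P, Q]. *)
Inductive subalg_gen P Q : L -> Prop :=
| SubalgConst (c : K) : subalg_gen P Q c%:A
| SubalgL : subalg_gen P Q P
| SubalgR : subalg_gen P Q Q
| SubalgD G H :
    subalg_gen P Q G -> subalg_gen P Q H -> subalg_gen P Q (G + H)
| SubalgM G H :
    subalg_gen P Q G -> subalg_gen P Q H -> subalg_gen P Q (G * H).

End Bracket.

Definition cross (R : pzRingType) (u v : R * R) : R := u.1 * v.2 - u.2 * v.1.
Definition dot (R : pzRingType) (u v : R * R) : R := u.1 * v.1 + u.2 * v.2.

Section Directions.
Implicit Types A B u v : int * int.

Definition is_dir u : bool := gcdz u.1 u.2 == 1.

(* The counterclockwise angle from A to u lies in [0, pi[. *)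
Definition upper_half A u : bool :=
  (0 < cross A u) || (cross A u == 0) && (0 < dot A u).

(* Turning counterclockwise from A by less than a full turn, u is met no later
   than v: the angles from A to u and v, taken in [0, 2 pi[, are compared; two
   of them in the same half [0, pi[ or [pi, 2 pi[ are compared by the sign of
   the cross product. *)
Definition ccw_le A u v : bool :=
  if upper_half A u == upper_half A v then 0 <= cross u v else upper_half A u.

Definition ccw_lt A u v : bool := ~~ ccw_le A v u.

(* The directions of the arc [A, B[. *)
Definition in_arc A B u : bool := is_dir u && ccw_lt A u B.

End Directions.

Section Valuations.
Variables (K : fieldType) (l : nat).
Local Notation L := (laurent K l).
Implicit Types (P : L) (d A u w : int * int) (e : int * nat).

Definition pt e : rat * rat := (e.1%:~R / l%:R, e.2%:R).
Definition dirq d : rat * rat := (d.1%:~R, d.2%:~R).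

Definition vexp d e : rat := dot (dirq d) (pt e).

Definition vdeg d P : \bar rat :=
  \big[maxe/-oo%E]_(e <- msupp P) (vexp d e)%:E.

Definition lead d P : L :=
  \sum_(e <- msupp P | (vexp d e)%:E == vdeg d P) monomial l P@_e e.

Definition homogeneous d P : Prop := P = lead d P.

Definition Dir P d : bool := is_dir d && (1 < #|` msupp (lead d P)|)%N.

Definition in_segment (s e p : rat * rat) : Prop :=
  exists t : rat, [/\ 0 <= t <= 1,
    p.1 = s.1 + t * (e.1 - s.1) & p.2 = s.2 + t * (e.2 - s.2)].

Definition Supp P : seq (rat * rat) := [seq pt e | e <- msupp P].

(* s = st_d(P) and e = en_d(P): the endpoints of the segment spanned by the
   support of the leading form, which coincide when it is a monomial. *)
Definition is_st_en d P (s e : rat * rat) : Prop :=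
  [/\ s \in Supp (lead d P), e \in Supp (lead d P),
      forall p, p \in Supp (lead d P) -> in_segment s e p
    & s != e -> 0 < cross (dirq d) (e - s)].

Definition is_en d P (e : rat * rat) : Prop := exists s, is_st_en d P s e.

(* The directions u of Dir(P) in I_0 = [A, (0,-1)[ such that v_w(P) > 0 for all
   directions w between A and u in I_0. *)
Definition pos_dir A P u : Prop :=
  [/\ Dir P u, in_arc A (0, -1) u
    & forall w, in_arc A (0, -1) w -> ccw_le A A w -> ccw_le A w u ->
        (0 < vdeg w P)%E].

Definition is_max_pos_dir A P u : Prop :=
  pos_dir A P u /\ forall w, pos_dir A P w -> ccw_le A w u.

End Valuations.

(* Main.v *)
(* For a direction u, let v_u be the degree and l_u the leading form.

   Elements of a fixed degree commuting with l_u(P) form a line when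
   v_u(P) <> 0, by Euler's identity.  Hence, wherever [l_u(G), l_u(P)] = 0, the
   ratio v_u(G) / v_u(P) is locally constant.  If it fails to commute, then
   v_u(G) = v_u([G, P]) - v_u(P) + v_u(1,1), and the strict decrease of
   v_u(1,1) / v_u(P) beyond the initial direction (where it equals p/(qm),
   because b > a/l) contradicts a constant ratio.  So, by continuity along the
   arc, the ratio stays equal to its value at the start for Q, then for the G_i
   with i >= 1 by descending induction from the last nonzero one, and finally
   for G_0.

   At the start the ratios are n/m for Q and r_0 - r_1 = p/(qm) - 1 for G_0 and
   G_1.  Along the whole arc the quotients of homogeneous elements commuting
   with l_u(P) thus reach the degree v_u(P)/(qm), by Bezout's identity, and a
   quotient N / D with N^(qm) proportional to l_u(P) D^(qm) is an element of the
   ring, because K[t] is normal. *)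
Require Import Defs.
From mathcomp Require Import all_boot all_order all_algebra.
From mathcomp Require Import finmap monalg zify ring lra.
From mathcomp Require Import constructive_ereal.

Set Implicit Arguments.
Unset Strict Implicit.
Unset Printing Implicit Defensive.

Import Order.TTheory GRing.Theory Num.Theory.
Local Open Scope ring_scope.

(** Two devices shape the development. Multiplying [P, Q] by x y replaces partial derivatives by
    logarithmic ones, which keep every exponent: [logbr] is l x y [P, Q], and degrees add under it
    without shift, the degree u.1 + u.2 of x y being carried separately. Directions are allowed to
    be arbitrary nonzero rational vectors, so that the arc can be followed along straight chords;
    there the degree of a fixed element is a maximum of finitely many affine functions of the
    parameter, and continuity becomes an induction on breakpoints. A chord from the initial
    direction covers less than half a turn; farther directions need a second chord, from (-1, 1).

    The initial direction needs separate care. Commutation there is not known for Q and fails for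
    G_0, so the ratio just beyond it cannot come from Euler's identity. For Q it is read off the end
    points of P and Q; for G_0 it follows from the relation l(G_1) F = l(G_0) l(P) together with the
    end points of F and P. *)

Lemma seq_argmax (T : eqType) (f : T -> rat) (s : seq T) : s != [::] ->
  {x | x \in s & forall y, y \in s -> f y <= f x}.
Proof.
elim: s => // x [|y s] IH _.
  by exists x; rewrite ?mem_head // => y; rewrite inE => /eqP->.
have [//|z zs zmax] := IH.
have [fle|flt] := leP (f x) (f z).
  exists z; first by rewrite in_cons zs orbT.
  by move=> t; rewrite in_cons => /predU1P[->|/zmax].
exists x; first exact: mem_head.
move=> t; rewrite in_cons => /predU1P[->//|/zmax le].
exact: le_trans le (ltW flt).
Qed.

(** * Algebras with a basis of monomials *)

(* The arguments below use laurent only through this interface, which hides the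
   convolution product: unfolding it makes conversion tests intractable. *)
Record laurent_model (K : fieldType) := LaurentModel {
  carrier :> comAlgType K;
  coef : carrier -> int * nat -> K;
  mono : K -> int * nat -> carrier;
  supp : carrier -> seq (int * nat);
  coef_ext : forall P Q, coef P =1 coef Q -> P = Q;
  coef_linear : forall c P Q e, coef (c *: P + Q) e = c * coef P e + coef Q e;
  coef_mono : forall c e f, coef (mono c e) f = c *+ (e == f);
  monoM : forall a b e f, mono a e * mono b f = mono (a * b) (expD e f);
  mono1 : mono 1 (0, 0%N) = 1;
  supp_uniq : forall P, uniq (supp P);
  mem_supp : forall P e, (e \in supp P) = (coef P e != 0)
}.

Section Coefficients.
Variables (K : fieldType) (L : laurent_model K).
Implicit Types (P Q R : L) (e f : int * nat) (chi : int * nat -> K).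

Lemma coef_add P Q e : coef (P + Q) e = coef P e + coef Q e.
Proof. by rewrite -[P]scale1r coef_linear scale1r mul1r. Qed.

Lemma coef_zero e : coef (0 : L) e = 0.
Proof. by apply: (addrI (coef (0 : L) e)); rewrite -coef_add !addr0. Qed.

Lemma coef_scale (c : K) P e : coef (c *: P) e = c * coef P e.
Proof. by rewrite -[c *: P]addr0 coef_linear coef_zero addr0. Qed.

Lemma coef_opp P e : coef (- P) e = - coef P e.
Proof. by rewrite -scaleN1r coef_scale mulN1r. Qed.

Lemma coef_bigsum (I : Type) (r : seq I) (F : I -> L) e :
  coef (\sum_(i <- r) F i) e = \sum_(i <- r) coef (F i) e.
Proof.
by elim: r => [|i r IH]; rewrite ?big_nil ?coef_zero // !big_cons coef_add IH.
Qed.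

Lemma coef_out P e : e \notin supp P -> coef P e = 0.
Proof. by rewrite mem_supp negbK => /eqP. Qed.

Lemma coef_sum_mono (c : int * nat -> K) (s : seq (int * nat)) e : uniq s ->
  coef (\sum_(f <- s) mono L (c f) f) e = if e \in s then c e else 0.
Proof.
move=> us; rewrite coef_bigsum; case: ifP => es.
  rewrite (bigD1_seq e) //= coef_mono eqxx mulr1n big1 ?addr0 //.
  by move=> f /negPf; rewrite coef_mono => ->.
rewrite big_seq big1 // => f fs; rewrite coef_mono.
by case: eqP fs => // ->; rewrite es.
Qed.

Lemma monoE P : P = \sum_(e <- supp P) mono L (coef P e) e.
Proof.
apply: coef_ext => e; rewrite (coef_sum_mono (coef P)) ?supp_uniq //.
by case: ifP => // /negbT /coef_out.
Qed.

Lemma mono_add a b e : mono L (a + b) e = mono L a e + mono L b e.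
Proof.
by apply: coef_ext => f; rewrite coef_add !coef_mono mulrnDl.
Qed.

Lemma mono0 e : mono L 0 e = 0.
Proof. by apply: coef_ext => f; rewrite coef_mono mul0rn coef_zero. Qed.

Lemma monoZ c a e : c *: mono L a e = mono L (c * a) e.
Proof. by apply: coef_ext => f; rewrite coef_scale !coef_mono mulrnAr. Qed.

Lemma mem_supp_mono c e f : f \in supp (mono L c e) -> f = e.
Proof. by rewrite mem_supp coef_mono; case: (e =P f);
  rewrite ?mulr0n ?eqxx. Qed.

Lemma supp0F e : (e \in supp (0 : L)) = false.
Proof. by rewrite mem_supp coef_zero eqxx. Qed.

Lemma mem_suppD P Q e : e \in supp (P + Q) -> e \in supp P \/ e \in supp Q.
Proof.
rewrite !mem_supp coef_add; have [->|_] := eqVneq (coef P e) 0; last by left.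
by rewrite add0r; right.
Qed.

Lemma mem_supp_sum (I : eqType) (r : seq I) (F : I -> L) e :
  e \in supp (\sum_(i <- r) F i) -> exists2 i, i \in r & e \in supp (F i).
Proof.
elim: r => [|i r IH]; rewrite ?big_nil ?supp0F // big_cons.
move=> /mem_suppD[eF|/IH[j jr eF]]; first by exists i; rewrite ?mem_head.
by exists j; rewrite // in_cons jr orbT.
Qed.

Lemma mem_suppM P Q e : e \in supp (P * Q) ->
  exists f g, [/\ f \in supp P, g \in supp Q & e = expD f g].
Proof.
rewrite [P in supp (P * _)]monoE [Q in supp (_ * Q)]monoE mulr_suml.
move=> /mem_supp_sum[f fP]; rewrite mulr_sumr => /mem_supp_sum[g gQ].
by rewrite monoM => /mem_supp_mono ->; exists f, g.
Qed.

Lemma logder_subproof chi P : {D : L | forall e, coef D e = chi e * coef P e}.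
Proof.
exists (\sum_(e <- supp P) mono L (chi e * coef P e) e) => e.
rewrite (coef_sum_mono (fun e => chi e * coef P e)) ?supp_uniq //.
by case: ifP => // /negbT /coef_out ->; rewrite mulr0.
Qed.

(** For additive [chi] this is a derivation, diagonal on monomials; [chi1] and [chi2] below give l x
    d/dx and y d/dy. *)
Definition logder chi P : L := sval (logder_subproof chi P).

Lemma coef_logder chi P e : coef (logder chi P) e = chi e * coef P e.
Proof. exact: (svalP (logder_subproof chi P)). Qed.

Lemma supp_logder chi P e : e \in supp (logder chi P) -> e \in supp P.
Proof. by rewrite !mem_supp coef_logder mulf_eq0 negb_or => /andP[]. Qed.

Lemma logderD chi P Q : logder chi (P + Q) = logder chi P + logder chi Q.
Proof.
by apply: coef_ext => e; rewrite coef_add !coef_logder coef_add mulrDr.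
Qed.

Lemma logderZ chi c P : logder chi (c *: P) = c *: logder chi P.
Proof.
by apply: coef_ext => e; rewrite coef_scale !coef_logder coef_scale mulrCA.
Qed.

Lemma logderN chi P : logder chi (- P) = - logder chi P.
Proof. by rewrite -scaleN1r logderZ scaleN1r. Qed.

Lemma logderB chi P Q : logder chi (P - Q) = logder chi P - logder chi Q.
Proof. by rewrite logderD logderN. Qed.

Lemma logder0 chi : logder chi 0 = 0 :> L.
Proof. by apply: coef_ext => e; rewrite coef_logder coef_zero mulr0. Qed.

Lemma logder_mono chi c e : logder chi (mono L c e) = mono L (chi e * c) e.
Proof.
apply: coef_ext => f; rewrite coef_logder !coef_mono.
by case: eqP => [->|]; rewrite ?mulr1n // !mulr0n mulr0.
Qed.

Lemma logder_sum chi (I : Type) (r : seq I) (F : I -> L) :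
  logder chi (\sum_(i <- r) F i) = \sum_(i <- r) logder chi (F i).
Proof.
by elim: r => [|i r IH]; rewrite ?big_nil ?logder0 // !big_cons logderD IH.
Qed.

Lemma logderE chi P : logder chi P =
  \sum_(e <- supp P) mono L (chi e * coef P e) e.
Proof.
by rewrite [P in LHS]monoE logder_sum; apply: eq_bigr => e _;
  rewrite logder_mono.
Qed.

Lemma logderM chi (chiD : forall e f, chi (expD e f) = chi e + chi f) P Q :
  logder chi (P * Q) = logder chi P * Q + P * logder chi Q.
Proof.
have key (s t : seq (int * nat)) (a b : int * nat -> K) :
    let M r c := \sum_(e <- r) mono L (c e) e in
    logder chi (M s a * M t b)
    = M s (fun e => chi e * a e) * M t b + M s a * M t (fun e => chi e * b e).
  rewrite /= !mulr_suml logder_sum -big_split /=.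
  apply: eq_bigr => e _; rewrite !mulr_sumr logder_sum -big_split /=.
  apply: eq_bigr => f _; rewrite monoM logder_mono !monoM -mono_add chiD.
  by congr mono; ring.
by have := key (supp P) (supp Q) (coef P) (coef Q);
  rewrite /= -!logderE -!monoE.
Qed.

End Coefficients.

(** * The bracket in logarithmic derivatives *)

Section LogBracket.
Variables (K : fieldType) (L : laurent_model K).
Hypothesis charK : [pchar K] =i pred0.
Implicit Types (P Q R : L) (e f : int * nat).

Definition chi1 e : K := e.1%:~R.
Definition chi2 e : K := e.2%:R.

Lemma chi1D e f : chi1 (expD e f) = chi1 e + chi1 f.
Proof. by rewrite /chi1 /= rmorphD. Qed.

Lemma chi2D e f : chi2 (expD e f) = chi2 e + chi2 f.
Proof. by rewrite /chi2 /= natrD. Qed.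

Lemma char0_natr_eq0 n : (n%:R == 0 :> K) = (n == 0%N).
Proof. exact: (pcharf0P K).1 charK n. Qed.

Lemma char0_intr_eq0 (z : int) : (z%:~R == 0 :> K) = (z == 0).
Proof.
case: z => n; first by rewrite char0_natr_eq0.
by rewrite NegzE mulrNz oppr_eq0 char0_natr_eq0 oppr_eq0.
Qed.

Lemma chi_inj e f : chi1 e = chi1 f -> chi2 e = chi2 f -> e = f.
Proof.
case: e f => [i j] [i' j'] /eqP; rewrite /chi1 /chi2 /= -subr_eq0 -intrB.
rewrite char0_intr_eq0 subr_eq0 => /eqP-> /eqP.
rewrite -subr_eq0 !pmulrn -intrB char0_intr_eq0 subr_eq0.
by move=> /eqP[->].
Qed.

Definition logbr P Q : L :=
  logder chi1 P * logder chi2 Q - logder chi1 Q * logder chi2 P.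

Lemma logbrDl P Q R : logbr (P + Q) R = logbr P R + logbr Q R.
Proof. by rewrite /logbr !logderD; ring. Qed.

Lemma logbrDr P Q R : logbr R (P + Q) = logbr R P + logbr R Q.
Proof. by rewrite /logbr !logderD; ring. Qed.

Lemma logbrMl P Q R : logbr (P * Q) R = logbr P R * Q + P * logbr Q R.
Proof. by rewrite /logbr !(logderM chi1D, logderM chi2D); ring. Qed.

End LogBracket.

(** * Degrees and leading forms *)

Section Weights.
Variables (K : fieldType) (L : laurent_model K) (l : nat).
Hypothesis l_gt0 : (0 < l)%N.
Implicit Types (P Q R : L) (e f : int * nat) (u v : rat * rat).

Definition weight u e : rat := dot u (pt l e).

Lemma wtD u e f : weight u (expD e f) = weight u e + weight u f.
Proof. by rewrite /weight /dot /pt /= rmorphD natrD /=; ring. Qed.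

Lemma wt_inj (s : seq (int * nat)) : exists u, {in s &, injective (weight u)}.
Proof.
pose M := \max_(e <- s) e.2.
(* The weight of (i, j) becomes (M + 1) i + j, which separates exponents because 0 <= j <= M. *)
exists (l%:R * M.+1%:R, 1) => -[i j] [i' j'] es fs.
have /= jM : (j <= M)%N := @leq_bigmax_seq _ s xpredT snd _ es isT.
have /= jM' : (j' <= M)%N := @leq_bigmax_seq _ s xpredT snd _ fs isT.
have l0 : l%:R != 0 :> rat by rewrite pnatr_eq0 -lt0n.
rewrite /weight /dot /pt /= !mul1r.
have wE (k : int) (n : nat) : l%:R * M.+1%:R * (k%:~R / l%:R) + n%:R
    = ((M.+1)%:Z * k + n%:Z)%:~R :> rat.
  rewrite rmorphD rmorphM /= -!pmulrn; field; exact: l0.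
rewrite !wE => /eqP; rewrite eqr_int => /eqP H.
have ii : i = i' by nia.
by rewrite ii in H *; congr pair; lia.
Qed.

Lemma supp_neq0 P e : e \in supp P -> P != 0.
Proof. by apply: contraTneq => ->; rewrite supp0F. Qed.

Lemma neq0_supp P : P != 0 -> exists e, e \in supp P.
Proof.
move=> P0; case sP: (supp P) => [|e s]; last by exists e; rewrite mem_head.
case/eqP: P0; apply: coef_ext => e.
by rewrite coef_zero coef_out // sP.
Qed.

Lemma deg_subproof u P : {d : rat | P != 0 ->
  (exists2 e, e \in supp P & weight u e = d)
  /\ forall e, e \in supp P -> weight u e <= d}.
Proof.
have [s0|sP] := eqVneq (supp P) [::].
  by exists 0 => /neq0_supp[e]; rewrite s0.
have [e eP emax] := seq_argmax (weight u) sP.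
by exists (weight u e) => _; split=> //; exists e.
Qed.

(** Kept rational, with an unspecified value at 0, so that linear arithmetic applies directly. *)
Definition deg u P : rat := sval (deg_subproof u P).

Lemma deg_attained u P :
  P != 0 -> exists2 e, e \in supp P & weight u e = deg u P.
Proof. by move=> /(svalP (deg_subproof u P))[]. Qed.

Lemma weight_le_deg u P e : e \in supp P -> weight u e <= deg u P.
Proof.
by move=> eP; have [_] := svalP (deg_subproof u P) (supp_neq0 eP); apply.
Qed.

Lemma deg_eq u P e : e \in supp P ->
  (forall f, f \in supp P -> weight u f <= weight u e) -> deg u P = weight u e.
Proof.
move=> eP emax; apply/eqP; rewrite eq_le weight_le_deg // andbT.
by have [f fP <-] := deg_attained u (supp_neq0 eP); apply: emax.
Qed.

Lemma ldf_subproof u (a : rat) P :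
  {Q : L | forall e, coef Q e = if weight u e == a then coef P e else 0}.
Proof.
exists (\sum_(e <- supp P) mono L (if weight u e == a then coef P e else 0) e)
  => e.
rewrite (coef_sum_mono L (fun e =>
  if weight u e == a then coef P e else 0)) ?supp_uniq //.
by case: ifP => // /negbT /coef_out ->; rewrite if_same.
Qed.

Definition ldf u P : L := sval (ldf_subproof u (deg u P) P).

Lemma coef_ldf u P e :
  coef (ldf u P) e = if weight u e == deg u P then coef P e else 0.
Proof. exact: (svalP (ldf_subproof u (deg u P) P)). Qed.

Lemma supp_ldf u P e :
  (e \in supp (ldf u P)) = (e \in supp P) && (weight u e == deg u P).
Proof.
by rewrite !mem_supp coef_ldf; case: ifP; rewrite ?andbT ?andbF // eqxx.
Qed.

Lemma ldf_neq0 u P : P != 0 -> ldf u P != 0.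
Proof.
move=> /(deg_attained u)[e eP we].
by apply: (@supp_neq0 _ e); rewrite supp_ldf eP we eqxx.
Qed.

Lemma supp_sub_ldf u P e : e \in supp (P - ldf u P) -> weight u e < deg u P.
Proof.
rewrite mem_supp coef_add coef_opp coef_ldf.
have [_|ne] := eqVneq (weight u e) (deg u P); first by rewrite subrr eqxx.
by rewrite subr0 -mem_supp => eP; rewrite lt_neqAle ne weight_le_deg.
Qed.

Lemma leading_part u a P Q : P != 0 ->
  (forall e, e \in supp P -> weight u e = a) ->
  (forall e, e \in supp Q -> weight u e < a) ->
  [/\ P + Q != 0, deg u (P + Q) = a & ldf u (P + Q) = P].
Proof.
move=> P0 Pa Qa.
have PQ e : weight u e = a -> coef (P + Q) e = coef P e.
  move=> we; rewrite coef_add (@coef_out _ _ Q) ?addr0 //.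
  by apply/negP => /Qa; rewrite we ltxx.
have [e eP] := neq0_supp P0.
have ePQ : e \in supp (P + Q) by rewrite mem_supp PQ ?Pa // -mem_supp.
have da : deg u (P + Q) = a.
  rewrite (deg_eq ePQ) ?Pa // => f /mem_suppD[/Pa-> //|/Qa/ltW//].
split=> //; first exact: supp_neq0 ePQ.
apply: coef_ext => f; rewrite coef_ldf da;
  have [/PQ //|/eqP wf] := eqVneq (weight u f) a.
by apply/esym/coef_out/negP => /Pa.
Qed.

Lemma homogP u a P : P != 0 -> (forall e, e \in supp P -> weight u e = a) ->
  deg u P = a /\ ldf u P = P.
Proof.
move=> P0 Pa; have := @leading_part u a P 0 P0 Pa; rewrite addr0.
by case=> // e; rewrite supp0F.
Qed.

Lemma ldf0 u : ldf u (0 : L) = 0.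
Proof. by apply: coef_ext => e; rewrite coef_ldf !coef_zero if_same. Qed.

Lemma deg_ldf u P : P != 0 -> deg u (ldf u P) = deg u P.
Proof.
move=> P0; have [] // := @homogP u (deg u P) (ldf u P); first exact: ldf_neq0.
by move=> e; rewrite supp_ldf => /andP[_ /eqP].
Qed.

Lemma ldf_id u P : ldf u (ldf u P) = ldf u P.
Proof.
have [->|P0] := eqVneq P 0; first by rewrite !ldf0.
have [] // := @homogP u (deg u P) (ldf u P); first exact: ldf_neq0.
by move=> e; rewrite supp_ldf => /andP[_ /eqP].
Qed.

Lemma wt_homog u P e : ldf u P = P -> e \in supp P -> weight u e = deg u P.
Proof. by move=> hP; rewrite -{1}hP supp_ldf => /andP[_ /eqP]. Qed.

Lemma coefM_top u P Q e f :
  (forall g, g \in supp P -> g != e -> weight u g < weight u e) ->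
  (forall g, g \in supp Q -> g != f -> weight u g < weight u f) ->
  coef (P * Q) (expD e f) = coef P e * coef Q f.
Proof.
have split R h : exists2 R', R = mono L (coef R h) h + R' &
    forall g, g \in supp R' -> (g \in supp R) && (g != h).
  exists (R - mono L (coef R h) h); first by rewrite addrC subrK.
  move=> g; rewrite !mem_supp coef_add coef_opp coef_mono.
  have [->|_] := eqVneq h g; first by rewrite mulr1n subrr eqxx.
  by rewrite mulr0n subr0 andbT.
have [P' eP sP] := split P e; have [Q' eQ sQ] := split Q f.
move=> topP topQ.
have -> : P * Q = mono L (coef P e) e * mono L (coef Q f) f
   + (mono L (coef P e) e * Q' + P' * Q).
  by rewrite {1}eP {1 3}eQ; ring.
rewrite coef_add monoM coef_mono eqxx mulr1n.
rewrite (@coef_out _ _ (_ + _)) ?addr0 //; apply/negP.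
case/mem_suppD => /mem_suppM[g [h [gP hQ]]] /(congr1 (weight u)); rewrite !wtD.
  rewrite (mem_supp_mono gP).
  by have /andP[hQ' hf] := sQ _ hQ; have := topQ _ hQ' hf; lra.
have /andP[gP' ge] := sP _ gP; have := topP _ gP' ge.
have : weight u h <= weight u f by have [->//|hf] := eqVneq h f; exact/ltW/topQ.
by lra.
Qed.

Lemma inj_top u P : {in supp P &, injective (weight u)} -> P != 0 ->
  exists2 e, e \in supp P & forall g, g \in supp P -> g != e ->
    weight u g < weight u e.
Proof.
move=> inj P0; have [e eP we] := deg_attained u P0; exists e => // g gP ge.
rewrite lt_neqAle we weight_le_deg // andbT -we; apply/eqP => /inj eg.
by rewrite eg // eqxx in ge.
Qed.

(** A weight injective on both supports gives each factor a single top term, and the product of the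
    two top terms cannot cancel. *)
Lemma mul_neq0 P Q : P != 0 -> Q != 0 -> P * Q != 0.
Proof.
move=> P0 Q0; have [u inj] := wt_inj (supp P ++ supp Q).
have [|e eP etop] := @inj_top u P _ P0.
  by move=> x y xP yP; apply: inj; rewrite mem_cat (xP, yP).
have [|f fQ ftop] := @inj_top u Q _ Q0.
  by move=> x y xP yP; apply: inj; rewrite mem_cat (xP, yP) orbT.
apply: (@supp_neq0 _ (expD e f)).
by rewrite mem_supp (coefM_top etop ftop) mulf_neq0 -?mem_supp.
Qed.

Lemma mul_eq0 P Q : (P * Q == 0) = (P == 0) || (Q == 0).
Proof.
have [->|P0] := eqVneq P 0; first by rewrite mul0r eqxx.
have [->|Q0] := eqVneq Q 0; first by rewrite mulr0 eqxx.
exact/negbTE/mul_neq0.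
Qed.

Lemma mul_cancel P Q R : P != 0 -> P * Q = P * R -> Q = R.
Proof.
move=> P0 /eqP; rewrite -subr_eq0 -mulrBr mul_eq0 (negPf P0) /= subr_eq0.
by move/eqP.
Qed.

Lemma exp_neq0 P n : P != 0 -> P ^+ n != 0.
Proof.
move=> P0; elim: n => [|n IH]; first by rewrite expr0 oner_neq0.
by rewrite exprS mul_neq0.
Qed.

Lemma degM_ldfM u P Q : P != 0 -> Q != 0 ->
  deg u (P * Q) = deg u P + deg u Q /\ ldf u (P * Q) = ldf u P * ldf u Q.
Proof.
move=> P0 Q0.
have -> : P * Q = ldf u P * ldf u Q
    + ((P - ldf u P) * Q + ldf u P * (Q - ldf u Q)) by ring.
have [|||_ -> ->] := @leading_part u (deg u P + deg u Q) (ldf u P * ldf u Q)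
    ((P - ldf u P) * Q + ldf u P * (Q - ldf u Q)) => //.
- by apply: mul_neq0; exact: ldf_neq0.
- move=> e /mem_suppM[f [g [fP gQ ->]]]; rewrite wtD.
  by move: fP gQ; rewrite !supp_ldf => /andP[_ /eqP->] /andP[_ /eqP->].
move=> e /mem_suppD[]/mem_suppM[f [g [fP gQ ->]]]; rewrite wtD.
  by have := supp_sub_ldf fP; have := weight_le_deg u gQ; lra.
have := supp_sub_ldf gQ; move: fP; rewrite supp_ldf => /andP[_ /eqP->].
by lra.
Qed.

Lemma degM u P Q : P != 0 -> Q != 0 -> deg u (P * Q) = deg u P + deg u Q.
Proof. by move=> P0 Q0; have [] := degM_ldfM u P0 Q0. Qed.

Lemma ldfM u P Q : P != 0 -> Q != 0 -> ldf u (P * Q) = ldf u P * ldf u Q.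
Proof. by move=> P0 Q0; have [] := degM_ldfM u P0 Q0. Qed.

Lemma deg_mono u c e : c != 0 -> deg u (mono L c e) = weight u e.
Proof.
move=> c0; apply: deg_eq => [|f /mem_supp_mono-> //].
by rewrite mem_supp coef_mono eqxx.
Qed.

Lemma deg1 u : deg u (1 : L) = 0.
Proof.
rewrite -mono1 deg_mono ?oner_neq0 // /weight /dot /pt /=.
by rewrite mul0r !mulr0 addr0.
Qed.

Lemma degX u P n : P != 0 -> deg u (P ^+ n) = n%:R * deg u P.
Proof.
move=> P0; elim: n => [|n IH]; first by rewrite expr0 mul0r deg1.
by rewrite exprS degM ?exp_neq0 // IH -natr1; ring.
Qed.

Lemma ldfX u P n : P != 0 -> ldf u P = P -> ldf u (P ^+ n) = P ^+ n.
Proof.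
move=> P0 hP; elim: n => [|n IH].
  rewrite expr0; have [|_ ->] // := @homogP u 0 1 (oner_neq0 _).
  move=> e; rewrite -mono1 => /mem_supp_mono ->.
  by rewrite /weight /dot /pt /= mul0r !mulr0 addr0.
by rewrite exprS ldfM ?exp_neq0 // IH hP.
Qed.

(* A weight separating the exponents isolates the top coefficient of
   R = P - c Q: the equation forces it to sit at the top exponent of Q, where c
   was chosen to cancel it. *)
Lemma logder_proportional (charK : [pchar K] =i pred0) P Q : Q != 0 ->
  (forall chi, (chi = chi1 K \/ chi = chi2 K) ->
    logder chi P * Q = P * logder chi Q) ->
  exists c, P = c *: Q.
Proof.
move=> Q0 PQ; have [u inj] := wt_inj (supp P ++ supp Q).
have [|f fQ ftop] := @inj_top u Q _ Q0.
  by move=> x y xP yP; apply: inj; rewrite mem_cat (xP, yP) orbT.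
pose c := coef P f / coef Q f; exists c.
have f0 : coef Q f != 0 by rewrite -mem_supp.
pose R := P - c *: Q.
have Rf : coef R f = 0.
  by rewrite coef_add coef_opp coef_scale /c divfK // subrr.
have sR e : e \in supp R -> e \in supp P ++ supp Q.
  rewrite mem_cat !mem_supp coef_add coef_opp coef_scale.
  have [->|//] := eqVneq (coef P e) 0; have [->|//] := eqVneq (coef Q e) 0.
  by rewrite mulr0 subr0 eqxx.
have [R0|R0] := eqVneq R 0; first by apply/eqP; rewrite -subr_eq0; apply/eqP.
have [|e eR etop] := @inj_top u R _ R0.
  by move=> x y xP yP; apply: inj; apply: sR.
have chie chi : chi = chi1 K \/ chi = chi2 K -> chi e = chi f.
  move=> /PQ eq1.
  have eq2 : logder chi R * Q = R * logder chi Q.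
    rewrite /R logderB logderZ !mulrBl eq1; congr (_ - _).
    by rewrite -!scalerAl mulrC.
  have := congr1 (fun S : L => coef S (expD e f)) eq2.
  rewrite /= !(@coefM_top u) ?coef_logder //;
    try by move=> g /supp_logder; (exact: ftop || exact: etop).
  move=> eq3; apply/eqP; rewrite -subr_eq0.
  have /eqP : (chi e - chi f) * (coef R e * coef Q f) = 0.
    by rewrite mulrBl mulrA eq3; ring.
  by rewrite !mulf_eq0 (negPf f0) orbF; move: eR;
    rewrite mem_supp => /negPf->; rewrite orbF.
have ef : e = f by apply: (chi_inj charK); apply: chie; [left|right].
by move: eR; rewrite ef mem_supp Rf eqxx.
Qed.

End Weights.

(** * Commuting leading forms *)

Section Centralizer.
Variables (K : fieldType) (L : laurent_model K) (l : nat).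
Hypotheses (l_gt0 : (0 < l)%N) (charK : [pchar K] =i pred0).
Implicit Types (P Q R G A : L) (e f : int * nat) (u v w : rat * rat).
Local Notation wt := (weight l).
Local Notation deg := (deg l).
Local Notation ldf := (ldf l).

Lemma mem_supp_logbr P Q e : e \in supp (logbr P Q) ->
  exists f g, [/\ f \in supp P, g \in supp Q & e = expD f g].
Proof.
case/mem_suppD => [|]; last first.
  rewrite mem_supp coef_opp oppr_eq0 -mem_supp => /mem_suppM[f [g []]].
  move=> /supp_logder fQ /supp_logder gP ->; exists g, f.
  by split=> //; rewrite expDC.
by case/mem_suppM=> [f [g [/supp_logder fP /supp_logder gQ ->]]]; exists f, g.
Qed.

Lemma deg_logbr_le u P Q : logbr P Q != 0 ->
  deg u (logbr P Q) <= deg u P + deg u Q.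
Proof.
move=> /(deg_attained l u)[e /mem_supp_logbr[f [g [fP gQ ->]]] <-].
by rewrite wtD lerD // weight_le_deg.
Qed.

Lemma logbr_leading u P Q : logbr (ldf u P) (ldf u Q) != 0 ->
  [/\ logbr P Q != 0, deg u (logbr P Q) = deg u P + deg u Q
    & ldf u (logbr P Q) = logbr (ldf u P) (ldf u Q)].
Proof.
move=> B0.
have -> : logbr P Q = logbr (ldf u P) (ldf u Q)
    + (logbr (P - ldf u P) Q + logbr (ldf u P) (Q - ldf u Q)).
  have dl (x y z : L) : logbr x z = logbr y z + logbr (x - y) z.
    by rewrite -logbrDl addrC subrK.
  have dr (x y z : L) : logbr z x = logbr z y + logbr z (x - y).
    by rewrite -logbrDr addrC subrK.
  by rewrite (dl P (ldf u P) Q) (dr Q (ldf u Q) (ldf u P)); ring.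
apply: leading_part => // e.
  case/mem_supp_logbr=> f [g [fP gQ ->]]; rewrite wtD.
  by move: fP gQ; rewrite !supp_ldf => /andP[_ /eqP->] /andP[_ /eqP->].
case/mem_suppD=> /mem_supp_logbr[f [g [fP gQ ->]]]; rewrite wtD.
  by have := supp_sub_ldf fP; have := weight_le_deg l u gQ; lra.
have := supp_sub_ldf gQ; move: fP; rewrite supp_ldf => /andP[_ /eqP->].
by lra.
Qed.

Lemma logbrX P Q n : logbr P Q = 0 -> logbr (P ^+ n) Q = 0.
Proof.
move=> PQ; elim: n => [|n IH];
  last by rewrite exprS logbrMl PQ IH mul0r mulr0 addr0.
have := logbrMl (1 : L) 1 Q; rewrite expr0 !mul1r mulr1 => H.
by apply: (addrI (logbr 1 Q)); rewrite -H addr0.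
Qed.

Lemma logbr_xx P : logbr P P = 0.
Proof. by rewrite /logbr subrr. Qed.

Lemma logbrM0 P Q R : logbr P R = 0 -> logbr Q R = 0 -> logbr (P * Q) R = 0.
Proof. by rewrite logbrMl => -> ->; rewrite mul0r mulr0 addr0. Qed.

(** Degrees are rational while coefficients live in K; clearing denominators yields integers, which
    can be cast into both. *)
Lemma wt_int u : exists N (a b : int), N != 0 /\
  forall e, N%:~R * wt u e = (a * e.1 + b * e.2%:Z)%:~R.
Proof.
have := (denq_neq0 u.1, denq_neq0 u.2);
  have := (divq_num_den u.1, divq_num_den u.2).
move: (numq u.1) (denq u.1) (numq u.2) (denq u.2) =>
  n1 d1 n2 d2 [e1 e2] [d10 d20].
exists (d1 * d2 * l%:Z), (n1 * d2), (n2 * d1 * l%:Z).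
split; first by rewrite !mulf_neq0 // eqz_nat; lia.
move=> e; rewrite /weight /dot /pt /= -e1 -e2 !(rmorphD, rmorphM) /= -!pmulrn.
by field; rewrite !intr_eq0 d10 d20 pnatr_eq0; lia.
Qed.

(** The weight a e.1 + b e.2 is constant on the support of a homogeneous element, which is thus an
    eigenvector of a derivation. The same a, b, N serve all elements, so eigenvalues compare as
    degrees do. *)
Lemma euler u : exists a b N : int, N != 0 /\ forall A, A != 0 -> ldf u A = A ->
  exists z : int, z%:~R = N%:~R * deg u A /\
   (z%:~R : K)%:A * A = (a%:~R : K)%:A * logder (@chi1 K) A
                       + (b%:~R : K)%:A * logder (@chi2 K) A.
Proof.
have [N [a [b [N0 wtE]]]] := wt_int u; exists a, b, N; split=> // A A0 hA.
have [e0 e0A we0] := deg_attained l u A0.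
exists (a * e0.1 + b * e0.2%:Z); split; first by rewrite -wtE we0.
apply: coef_ext => e; rewrite !mulr_algl coef_add !coef_scale !coef_logder.
have [/coef_out->|] := boolP (e \notin supp A); first by rewrite !mulr0 addr0.
rewrite negbK => /(wt_homog hA) we.
have /eqP : (a * e.1 + b * e.2%:Z)%:~R = (a * e0.1 + b * e0.2%:Z)%:~R :> rat.
  by rewrite -!wtE we we0.
rewrite eqr_int => /eqP <-.
by rewrite /chi1 /chi2 rmorphD !rmorphM /= -!pmulrn; ring.
Qed.

(* By Euler's identity the elements of a given degree that commute with a
   homogeneous p of nonzero degree have the same logarithmic derivatives. *)
Lemma centralizer_line u p A1 A2 : p != 0 -> ldf u p = p -> deg u p != 0 ->
  A1 != 0 -> ldf u A1 = A1 -> logbr A1 p = 0 ->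
  A2 != 0 -> ldf u A2 = A2 -> logbr A2 p = 0 ->
  deg u A1 = deg u A2 -> exists2 c, c != 0 & A1 = c *: A2.
Proof.
move=> p0 hp dp A10 hA1 cA1 A20 hA2 cA2 dA.
have [a [b [N [N0 eul]]]] := euler u.
have [zp [zpE eulp]] := eul _ p0 hp.
have [z1 [z1E eul1]] := eul _ A10 hA1; have [z2 [z2E eul2]] := eul _ A20 hA2.
have zz : z1 = z2.
  by apply/eqP; rewrite -(eqr_int rat) z1E z2E dA.
have zp0 : zp != 0.
  by rewrite -(intr_eq0 rat) zpE mulf_neq0 // intr_eq0.
suff [c A1E] : exists c, A1 = c *: A2.
  exists c => //; apply: contraNneq A10 => c0.
  by rewrite A1E c0 scale0r.
apply: (logder_proportional l_gt0 charK) => // chi chiE.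
have zp0' : (zp%:~R : K)%:A * p != 0.
  rewrite mulr_algl; apply: contraNneq p0 => /(congr1 ( *:%R (zp%:~R^-1))).
  rewrite scalerA mulVf ?char0_intr_eq0 // scale1r scaler0.
  by move=> ->.
(* Commutation exchanges the two derivations between A and p, turning Euler's expression for p into
   the one for A. So the logarithmic derivatives of A are z1 / zp times those of p. *)
have key A : (z1%:~R : K)%:A * A = (a%:~R : K)%:A * logder (@chi1 K) A
      + (b%:~R : K)%:A * logder (@chi2 K) A -> logbr A p = 0 ->
    (zp%:~R : K)%:A * p * logder chi A = (z1%:~R : K)%:A * A * logder chi p.
  rewrite eulp => -> /eqP; rewrite /logbr subr_eq0 => /eqP cA.
  case: chiE => ->.
    rewrite mulrDl [RHS]mulrDl; congr (_ + _); first by ring.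
    by rewrite -!mulrA [logder (@chi2 K) p * _]mulrC cA; ring.
  rewrite mulrDl [RHS]mulrDl; congr (_ + _); last by ring.
  by rewrite -!mulrA -cA; ring.
apply: (mul_cancel l_gt0 zp0').
rewrite zz in eul1 key.
rewrite mulrA key // [RHS]mulrCA key //; ring.
Qed.

End Centralizer.

(** * Propagation along a segment of directions *)

Lemma right_gap (s : rat) (B : seq rat) :
  exists2 t, s < t & forall b, b \in B -> ~~ (s < b < t).
Proof.
elim: B => [|b B [t st tB]]; first by exists (s + 1) => //; lra.
have [sb|bs] := ltP s b.
  exists (Num.min b t); first by rewrite lt_min sb st.
  move=> c; rewrite in_cons => /predU1P[->|/tB]; rewrite lt_min ?ltxx ?andbF //.
  by apply: contra => /and3P[-> _ ->].
exists t => // c; rewrite in_cons => /predU1P[->|/tB //].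
by rewrite ltNge bs.
Qed.

Lemma ltn_count (T : eqType) (a1 a2 : pred T) (s : seq T) x :
  subpred a1 a2 -> x \in s -> ~~ a1 x -> a2 x -> (count a1 s < count a2 s)%N.
Proof.
move=> sub; elim: s => // y s IH; rewrite in_cons => /predU1P[<-|xs] n1 a2x /=.
  by rewrite (negPf n1) a2x add0n add1n ltnS sub_count.
apply: leq_ltn_trans (_ : a1 y + count a1 s <= a2 y + count a1 s)%N _.
  by rewrite leq_add2r; case: (boolP (a1 y)) => // /sub ->.
by rewrite ltn_add2l IH.
Qed.

(* Induction on the number of breakpoints below t. *)
Lemma piecewise_affine_zero (phi : rat -> rat) (B : seq rat) :
  (forall s t, s < t -> (forall b, b \in B -> ~~ (s < b < t)) ->
    exists a c, forall x, s <= x <= t -> phi x = a + c * x) ->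
  (forall s, 0 <= s < 1 -> phi s = 0 ->
    exists2 t, s < t & forall x, s <= x <= t -> phi x = 0) ->
  phi 0 = 0 -> forall t, 0 <= t <= 1 -> phi t = 0.
Proof.
move=> aff germ phi0 t; have [n] := ubnP (count [pred b | 0 < b < t] B).
elim: n t => // n IH t; rewrite ltnS => lt_n /andP[t0 t1].
have [->//|tn0] := eqVneq t 0.
have tpos : 0 < t by rewrite lt_neqAle eq_sym tn0.
have sne : 0 :: [seq b <- B | 0 < b < t] != [::] by [].
(* s is 0 or the last breakpoint before t. On [s, t] phi is affine, and it vanishes at s and, by the
   germ hypothesis, at a second point. *)
have [s sB smax] := seq_argmax (fun b => b) sne.
have [s0 st] : 0 <= s /\ s < t.
  move: sB; rewrite in_cons => /predU1P[->//|].
  by rewrite mem_filter => /andP[/andP[/ltW]].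
have gap b : b \in B -> ~~ (s < b < t).
  move=> bB; apply/negP => /andP[sb bt].
  have : b \in 0 :: [seq b <- B | 0 < b < t].
    by rewrite in_cons mem_filter (le_lt_trans s0 sb) bt bB orbT.
  by move=> /smax; rewrite leNgt sb.
have phis : phi s = 0.
  move: sB; rewrite in_cons => /predU1P[->//|]; rewrite mem_filter.
  move=> /andP[/andP[spos _] sB]; apply: IH;
    last by rewrite s0 (le_trans (ltW st)).
  apply: leq_trans lt_n; apply: (@ltn_count _ _ _ _ s) => //=.
  + by move=> b /= /andP[-> bs]; exact: lt_trans bs st.
  + by rewrite ltxx andbF.
  + by rewrite spos st.
have [a [c ac]] := aff _ _ st gap.
have [|x sx zx] := germ s _ phis; first by rewrite s0 (lt_le_trans st).
pose y := Num.min x t.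
have sy : s < y by rewrite lt_min sx st.
have yx : y <= x by rewrite ge_min lexx.
have yt : y <= t by rewrite ge_min lexx orbT.
have ey : a + c * y = 0 by rewrite -ac ?zx // (ltW sy).
have es : a + c * s = 0 by rewrite -ac ?phis // lexx ltW.
have c0 : c = 0.
  have /eqP : c * (y - s) = 0 by lra.
  by rewrite mulf_eq0 subr_eq0 (gt_eqF sy) orbF => /eqP.
by rewrite ac ?lexx ?(ltW st) //; move: es; rewrite c0 !mul0r.
Qed.

Definition line (u w : rat * rat) (t : rat) : rat * rat :=
  (u.1 + t * w.1, u.2 + t * w.2).

Lemma line0 u w : line u w 0 = u.
Proof. by rewrite /line !mul0r !addr0 -surjective_pairing. Qed.

Lemma line_line u w s t : line (line u w s) w t = line u w (s + t).
Proof. by rewrite /line /=; congr pair; ring. Qed.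

Section Germs.
Variables (K : fieldType) (L : laurent_model K) (l : nat).
Hypotheses (l_gt0 : (0 < l)%N) (charK : [pchar K] =i pred0).
Implicit Types (P Q R G A : L) (e f : int * nat) (u v w : rat * rat).
Local Notation wt := (weight l).
Local Notation deg := (deg l).
Local Notation ldf := (ldf l).

Lemma wt_line u w t e : wt (line u w t) e = wt u e + t * wt w e.
Proof. by rewrite /weight /dot /line /=; ring. Qed.

(* The parameters at which two exponents of P with different slopes have the
   same weight. *)
Definition breaks u w P : seq rat :=
  [seq (wt u f - wt u e) / (wt w e - wt w f) | e <- supp P, f <- supp P].

Lemma deg_affine u w P s t : P != 0 -> s < t ->
  (forall b, b \in breaks u w P -> ~~ (s < b < t)) ->
  exists2 e, e \in supp P & forall x, s <= x <= t ->
    deg (line u w x) P = wt (line u w x) e.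
Proof.
(* An exponent maximal at the midpoint stays maximal: another one overtaking it would meet it
   strictly inside the gap. *)
move=> P0 st gap; pose m := (s + t) / 2%:R.
have [sm mt] : s < m /\ m < t by rewrite /m; lra.
have [e eP em] := deg_attained l (line u w m) P0; exists e => // x /andP[sx xt].
apply: deg_eq => // f fP.
have hm : wt (line u w m) f <= wt (line u w m) e by rewrite em weight_le_deg.
rewrite !wt_line in hm *; rewrite leNgt; apply/negP => hx.
have ne : wt w e - wt w f != 0.
  by apply/eqP => h; nra.
pose b := (wt u f - wt u e) / (wt w e - wt w f).
have /gap/negP[] : b \in breaks u w P by apply/allpairsP; exists (e, f).
have bE : b * (wt w e - wt w f) = wt u f - wt u e by rewrite /b divfK.
have [pos|neg|] := ltrgt0P (wt w e - wt w f); last by move/eqP;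
  rewrite (negPf ne).
  have : x < b by nra.
  have : b <= m by nra.
  by move=> *; apply/andP; split; lra.
have : b < x by nra.
have : m <= b by nra.
by move=> *; apply/andP; split; lra.
Qed.

(** Just after 0 there is no breakpoint, so one exponent attains the degree on all of [0, t]; being
    maximal at 0, it belongs to the leading form. *)
Lemma deg_germ u w P : P != 0 -> exists2 t, 0 < t & forall x, 0 <= x <= t ->
  deg (line u w x) P = deg (line u w x) (ldf u P).
Proof.
move=> P0; have [t t0 gap] := right_gap 0 (breaks u w P).
have [e eP eE] := deg_affine P0 t0 gap; exists t => // x /andP[x0 xt].
have eL : e \in supp (ldf u P).
  by rewrite supp_ldf eP -{2}(line0 u w) eE ?line0 ?eqxx // lexx ltW.
apply/eqP; rewrite eq_le eE ?x0 // weight_le_deg //=.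
have [f + <-] := deg_attained l (line u w x) (ldf_neq0 l u P0).
by rewrite supp_ldf => /andP[fP _]; rewrite -eE ?x0 // weight_le_deg.
Qed.

Lemma degZ u c P : c != 0 -> deg u (c *: P) = deg u P.
Proof.
move=> c0; have [->|P0] := eqVneq P 0; first by rewrite scaler0.
have [e eP em] := deg_attained l u P0.
have s f : (f \in supp (c *: P)) = (f \in supp P).
  by rewrite !mem_supp coef_scale mulf_eq0 (negPf c0).
rewrite -em; apply: deg_eq; first by rewrite s.
by move=> f; rewrite s em => /(weight_le_deg l u).
Qed.

(* If k r = j1 - j2, then ldf G ^ k * ldf P ^ j2 and ldf P ^ j1 commute with
   ldf P and have the same degree, so they are proportional; this fixes the
   ratio of the degrees in every direction near u. *)
Lemma ratio_germ u w G P (r : rat) : G != 0 -> P != 0 -> deg u P != 0 ->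
  logbr (ldf u G) (ldf u P) = 0 -> deg u G = r * deg u P ->
  exists2 t, 0 < t & forall x, 0 <= x <= t ->
    deg (line u w x) G = r * deg (line u w x) P.
Proof.
move=> G0 P0 dP cGP dG.
have g0 := ldf_neq0 l u G0; have p0 := ldf_neq0 l u P0.
have gh := ldf_id l u G; have ph := ldf_id l u P.
pose g := ldf u G; pose p := ldf u P.
have [k [j1 [j2 [k0 rE]]]] : exists k j1 j2 : nat, (0 < k)%N /\
    k%:R * r = j1%:R - j2%:R.
  have := divq_num_den r; have := denq_gt0 r.
  move: (numq r) (denq r) => z [k|k] // k0 <-.
  have kz : k%:R != 0 :> rat by rewrite pnatr_eq0; lia.
  case: z => z; [exists k, z, 0%N | exists k, 0%N, z.+1]; split; try lia.
    by rewrite subr0 mulrC -!pmulrn divfK.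
  by rewrite sub0r NegzE mulrC mulrNz -!pmulrn divfK.
pose A1 := g ^+ k * p ^+ j2; pose A2 := p ^+ j1.
have A10 : A1 != 0 by rewrite (mul_neq0 l_gt0) ?(exp_neq0 l_gt0).
have A20 : A2 != 0 by rewrite (exp_neq0 l_gt0).
have hom1 : ldf u A1 = A1.
  by rewrite (ldfM l_gt0) ?(exp_neq0 l_gt0) // !(ldfX l_gt0).
have hom2 : ldf u A2 = A2 by rewrite !(ldfX l_gt0).
have degA v : deg v A1 - deg v A2 = k%:R * (deg v g - r * deg v p).
  rewrite (degM l_gt0) ?(exp_neq0 l_gt0) // !(degX l_gt0) // mulrBr mulrA rE.
  ring.
have [||||c c0 A1E] := @centralizer_line _ _ _ l_gt0 charK u p A1 A2 p0 ph
   _ A10 hom1 _ A20 hom2.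
- by rewrite deg_ldf.
- by apply: logbrM0; apply: logbrX => //; rewrite logbr_xx.
- by apply: logbrX; rewrite logbr_xx.
- apply/eqP; rewrite -subr_eq0 degA !deg_ldf // dG subrr mulr0 //.
have [t1 t10 h1] := deg_germ u w G0; have [t2 t20 h2] := deg_germ u w P0.
exists (Num.min t1 t2); first by rewrite lt_min t10 t20.
move=> x /andP[x0]; rewrite le_min => /andP[xt1 xt2].
rewrite h1 ?x0 // h2 ?x0 //; apply/eqP; rewrite -subr_eq0.
have := degA (line u w x); rewrite A1E degZ // subrr => /esym/eqP.
by rewrite mulf_eq0 pnatr_eq0; case: k k0 {A1 A10 hom1 degA A1E rE}.
Qed.

(** The germ at 0 is a separate hypothesis, so that the segment may start where the leading forms do
    not commute. Later on, commutation has to be shown only where the ratio is already r, which lets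
    the argument bootstrap. *)
Lemma ratio_segment u w G P (r : rat) : G != 0 -> P != 0 ->
  (forall t, 0 <= t <= 1 -> deg (line u w t) P != 0) ->
  (forall t, 0 < t <= 1 -> deg (line u w t) G = r * deg (line u w t) P ->
    logbr (ldf (line u w t) G) (ldf (line u w t) P) = 0) ->
  (exists2 t, 0 < t & forall x, 0 <= x <= t ->
    deg (line u w x) G = r * deg (line u w x) P) ->
  forall t, 0 <= t <= 1 -> deg (line u w t) G = r * deg (line u w t) P.
Proof.
move=> G0 P0 dP comm germ t t01; apply/eqP; rewrite -subr_eq0; apply/eqP.
pose phi x := deg (line u w x) G - r * deg (line u w x) P.
apply: (@piecewise_affine_zero phi (breaks u w G ++ breaks u w P)) => //.
- move=> s x sx gap.
  have [|e _ eE] := deg_affine G0 sx (w := w) (u := u).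
    by move=> b bB; apply: gap; rewrite mem_cat bB.
  have [|f _ fE] := deg_affine P0 sx (w := w) (u := u).
    by move=> b bB; apply: gap; rewrite mem_cat bB orbT.
  exists (wt u e - r * wt u f), (wt w e - r * wt w f) => y sy.
  by rewrite /phi eE // fE // !wt_line; ring.
- move=> s /andP[s0 s1]; have [->|sn0] := eqVneq s 0.
    by case: germ => x x0 xE; exists x => // y y0; rewrite /phi xE // subrr.
  move/eqP; rewrite subr_eq0 => /eqP phis.
  have spos : 0 < s by rewrite lt_neqAle eq_sym sn0.
  have [||x x0 xE] := @ratio_germ (line u w s) w G P r G0 P0 _ _ phis.
  + by apply: dP; rewrite s0 ltW.
  + by apply: comm; rewrite // spos ltW.
  exists (s + x); first by lra.
  move=> y /andP[sy yx]; have := xE (y - s).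
  rewrite /phi line_line [s + _]addrC subrK => -> //; last by lra.
  by rewrite subrr.
by case: germ => x x0; rewrite /phi => -> //; rewrite ?subrr // lexx ltW.
Qed.

End Germs.

(** * Roots of homogeneous elements *)

Section Roots.
Variables (K : fieldType) (L : laurent_model K) (l : nat).
Implicit Types (P Q R : L) (e : int * nat) (u : rat * rat).
Local Notation wt := (weight l).
Local Notation deg := (deg l).
Local Notation ldf := (ldf l).

Definition mulexp (k : nat) e : int * nat := (k%:Z * e.1, (k * e.2)%N).

(* w is a primitive vector orthogonal to u in the lattice of exponents, oriented
   so that its second coordinate is nonnegative. *)
Lemma level_line (l_gt0 : (0 < l)%N) u : u != (0, 0) ->
  exists2 w : int * nat, w != (0, 0%N) &
  forall e f, wt u e = wt u f -> exists k : int,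
    e.1 = f.1 + k * w.1 /\ e.2%:Z = f.2%:Z + k * w.2%:Z.
Proof.
move=> u0; have [N [a [b [N0 wtE]]]] := wt_int l_gt0 u.
have ab0 : gcdz a b != 0.
  rewrite gcdz_eq0; apply: contraNN u0 => /andP[/eqP a0 /eqP b0].
  have wt0 e : wt u e = 0.
    apply/eqP; have := wtE e; rewrite a0 b0 !mul0r addr0 => /eqP.
    by rewrite mulf_eq0 intr_eq0 (negPf N0).
  have := wt0 (1, 0%N); have := wt0 (0, 1%N); rewrite /weight /dot /pt /=.
  rewrite mul0r !mulr0 add0r addr0 mulr1 mul1r => u2 /eqP.
  rewrite mulf_eq0 invr_eq0 pnatr_eq0 => /orP[/eqP u1|]; last by lia.
  by rewrite [u]surjective_pairing u1 u2.
have [s [t st]] := Bezoutz a b.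
have /dvdzP[a' aE] := dvdz_gcdl a b; have /dvdzP[b' bE] := dvdz_gcdr a b.
move: (gcdz a b) ab0 st aE bE => g g0 st aE bE.
have st1 : s * a' + t * b' = 1.
  by apply: (mulIf g0); rewrite mul1r -[RHS]st aE bE; ring.
(* The solutions are the multiples of (b', -a'), and the Bezout coefficients give the multiplier t x
   - s y explicitly. *)
have sol (x y : int) : a * x + b * y = 0 ->
    x = (t * x - s * y) * b' /\ y = - (t * x - s * y) * a'.
  move=> xy; have {}xy : a' * x + b' * y = 0.
    by apply: (mulIf g0); rewrite mul0r -xy aE bE; ring.
  have ex : x = s * (a' * x + b' * y) + (t * x - s * y) * b'.
    by rewrite -[LHS]mulr1 -st1; ring.
  have ey : y = t * (a' * x + b' * y) - (t * x - s * y) * a'.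
    by rewrite -[LHS]mulr1 -st1; ring.
  by split; [rewrite {1}ex | rewrite {1}ey]; rewrite xy mulr0 add0r // mulNr.
have diff e f : wt u e = wt u f ->
    a * (e.1 - f.1) + b * (e.2%:Z - f.2%:Z) = 0.
  move=> ef; have /eqP := wtE e; rewrite ef wtE eqr_int => /eqP; lia.
have ab' : (a' != 0) || (b' != 0).
  by rewrite -negb_and; apply: contra_eqN st1 => /andP[/eqP-> /eqP->]; lia.
case: (lerP a' 0) => a'0.
  exists (b', `|a'|%N).
    by apply: contraTneq ab' => -[-> /eqP]; rewrite absz_eq0 => /eqP->.
  move=> e f /diff /sol[ex ey];
    exists (t * (e.1 - f.1) - s * (e.2%:Z - f.2%:Z)) => /=.
  by split; [rewrite -ex; lia | rewrite lez0_abs // mulrN -mulNr -ey; lia].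
exists (- b', `|a'|%N).
  apply: contraTneq ab' => -[/eqP + /eqP]; rewrite absz_eq0 oppr_eq0.
  by move=> /eqP-> /eqP->.
move=> e f /diff /sol[ex ey];
  exists (- (t * (e.1 - f.1) - s * (e.2%:Z - f.2%:Z))) => /=.
by split; [rewrite mulrNN -ex; lia | rewrite gtz0_abs // -ey; lia].
Qed.

Variable w : int * nat.

(** Homogeneous elements are a monomial times a polynomial in the monomial of w, which moves
    questions of divisibility to K[t]. Asking for a nonzero constant term of f normalises the pair
    (e, f). *)
Definition ray e (f : {poly K}) : L := mono L 1 e * horner_alg (mono L 1 w) f.

Lemma mono_exp e k : mono L 1 e ^+ k = mono L 1 (mulexp k e).
Proof.
elim: k => [|k IH]; first by rewrite expr0 -mono1 /mulexp mul0r mul0n.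
rewrite exprS IH monoM mulr1 /mulexp /expD /=; congr (mono _ _ (_, _)); lia.
Qed.

Lemma rayE e (f : {poly K}) :
  ray e f = \sum_(i < size f) mono L f`_i (expD e (mulexp i w)).
Proof.
rewrite /ray -{1}[f]coefK poly_def rmorph_sum mulr_sumr.
apply: eq_bigr => i _; rewrite -mul_polyC rmorphM rmorphXn /= horner_algC.
by rewrite horner_algX mono_exp mulr_algl monoZ monoM mul1r mulr1.
Qed.

Lemma supp_ray e f e' : e' \in supp (ray e f) ->
  exists i, e' = expD e (mulexp i w).
Proof.
by rewrite rayE => /mem_supp_sum[i _ /mem_supp_mono->]; exists i.
Qed.

Lemma rayM e (f : {poly K}) e' (f' : {poly K}) :
  ray e f * ray e' f' = ray (expD e e') (f * f').
Proof.
have := monoM L 1 1 e e'; rewrite mulr1 => ee.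
by rewrite /ray rmorphM /= -ee mulrACA.
Qed.

Lemma rayX e (f : {poly K}) k : ray e f ^+ k = ray (mulexp k e) (f ^+ k).
Proof. by rewrite /ray rmorphXn exprMn mono_exp. Qed.

Lemma rayZ c e (f : {poly K}) : ray e (c *: f) = c *: ray e f.
Proof.
by rewrite /ray -mul_polyC rmorphM /= horner_algC mulr_algl scalerAr.
Qed.

Lemma expD_inj e : injective (expD e).
Proof.
by case: e => i j [a b] [a' b'] [/addrI -> /addnI ->].
Qed.

Hypothesis w0 : w != (0, 0%N).

Lemma mulexp_inj : injective (mulexp^~ w).
Proof.
move=> i j [/eqP e1 /eqP e2]; apply/eqP.
move: e1 e2 w0; case: w => [x y] /=; rewrite -subr_eq0 -mulrBl mulf_eq0.
case/orP; first by rewrite subr_eq0.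
by move=> /eqP ->; rewrite eqn_mul2r => /orP[/eqP->|//]; rewrite eqxx.
Qed.

Lemma coef_ray e f i : coef (ray e f) (expD e (mulexp i w)) = f`_i.
Proof.
have E j : (expD e (mulexp j w) == expD e (mulexp i w)) = (j == i).
  by rewrite (inj_eq (@expD_inj e)) (inj_eq mulexp_inj).
rewrite rayE coef_bigsum; have [lti|gei] := ltnP i (size f).
  rewrite (bigD1 (Ordinal lti)) //= coef_mono eqxx mulr1n big1 ?addr0 // => j.
  by rewrite coef_mono E -val_eqE /= => /negPf->.
rewrite nth_default // big1 // => j _; rewrite coef_mono E.
by rewrite ltn_eqF // (leq_trans (ltn_ord j)).
Qed.

(** Each origin lies on the ray of the other, at offsets i and j; since w is nonzero, i + j = 0. *)
Lemma ray_inj e (f : {poly K}) e' (f' : {poly K}) : f`_0 != 0 -> f'`_0 != 0 ->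
  ray e f = ray e' f' -> e = e' /\ f = f'.
Proof.
move=> f0 f'0 ff.
have mem a (h : {poly K}) : h`_0 != 0 -> a \in supp (ray a h).
  move=> h0; have aE : a = expD a (mulexp 0 w).
    by case: a => x y; rewrite /expD /mulexp /= mul0r mul0n addr0 addn0.
  by rewrite {1}aE mem_supp coef_ray.
have ee : e = e'.
  have := mem e f f0; rewrite ff => /supp_ray[i ei].
  have := mem e' f' f'0; rewrite -ff => /supp_ray[j ej].
  have ij : mulexp (i + j) w = mulexp 0 w.
    have [a1 a2] := (congr1 fst ei, congr1 snd ei).
    have [b1 b2] := (congr1 fst ej, congr1 snd ej).
    rewrite /expD /mulexp /= in a1 a2 b1 b2 *.
    by congr pair; nia.
  have /eqP := mulexp_inj ij; rewrite addn_eq0 => /andP[/eqP i0 _].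
  by rewrite ei i0 /expD /mulexp /= mul0r mul0n addr0 addn0 -surjective_pairing.
split=> //; apply/polyP => i.
by rewrite -(coef_ray e) ff -ee coef_ray.
Qed.

Lemma homog_ray u P :
  (forall e f, wt u e = wt u f -> exists k : int,
    e.1 = f.1 + k * w.1 /\ e.2%:Z = f.2%:Z + k * w.2%:Z) ->
  P != 0 -> ldf u P = P ->
  exists e (f : {poly K}), f`_0 != 0 /\ P = ray e f.
Proof.
move=> line P0 hP.
(* The scalar product with w increases along the line: its minimum on the support is the origin of
   the ray, and its differences bound the degree of the polynomial. *)
pose key e : int := w.1 * e.1 + w.2%:Z * e.2%:Z.
have sne : supp P != [::].
  by have [e] := neq0_supp P0; case: (supp P).
have [e0 e0P e0min] := seq_argmax (fun e => (- key e)%:~R) sne.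
have onray e : e \in supp P -> exists2 k, e = expD e0 (mulexp k w) &
    (k <= `|key e - key e0|)%N.
  move=> eP; have [|k [e1 e2]] := line e e0; first by rewrite !(wt_homog hP).
  have := e0min e eP; rewrite ler_int /key e1 e2.
  have w0' : (w.1 != 0) || (w.2 != 0%N).
    by case: (w) w0 => x y; rewrite xpair_eqE negb_and.
  move=> mn.
  have sq : 0 < w.1 * w.1 + w.2%:Z * w.2%:Z.
    by case/orP: w0' => /eqP w1; nia.
  have kE : key e - key e0 = k * (w.1 * w.1 + w.2%:Z * w.2%:Z).
    by rewrite /key e1 e2; ring.
  have k0 : 0 <= k by nia.
  exists `|k|%N; last first.
    have kle : k <= k * (w.1 * w.1 + w.2%:Z * w.2%:Z) by nia.
    by rewrite -kE in kle; lia.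
  rewrite [e]surjective_pairing /expD /mulexp /=; congr pair; first by lia.
  by apply/eqP; rewrite -eqz_nat e2 PoszD PoszM gez0_abs.
pose n := \max_(e <- supp P) `|key e - key e0|%N.
pose f := \poly_(i < n.+1) coef P (expD e0 (mulexp i w)).
have fE e k : e \in supp P -> e = expD e0 (mulexp k w) -> f`_k = coef P e.
  move=> eP ek; have [k' ek' kn] := onray e eP.
  have -> : k = k'.
    by apply: mulexp_inj; apply: (@expD_inj e0); rewrite -ek -ek'.
  rewrite coef_poly -ek' ltnS ifT //; apply: leq_trans kn _.
  exact: (@leq_bigmax_seq _ (supp P) xpredT (fun e => `|key e - key e0|%N)).
exists e0, f; split.
  rewrite (fE e0) -?mem_supp //.
  by rewrite /expD /mulexp /= mul0r mul0n addr0 addn0 -surjective_pairing.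
apply: coef_ext => e; have [eP|eP] := boolP (e \in supp P).
  have [k ek kn] := onray e eP.
  by rewrite [in RHS]ek coef_ray (fE e).
rewrite coef_out //; apply/esym/coef_out/negP => eR.
have [i ei] := supp_ray eR; move: eR; rewrite mem_supp ei coef_ray coef_poly.
by case: ifP; rewrite ?eqxx // -ei -mem_supp (negPf eP).
Qed.

End Roots.

Lemma homog_root (K : fieldType) (L : laurent_model K) (l : nat)
    (rootK : forall (k : nat) (c : K), (0 < k)%N -> exists z, z ^+ k = c)
    (l_gt0 : (0 < l)%N) (u : rat * rat) (k : nat) (p N D : L) (c : K) :
  u != (0, 0) -> (0 < k)%N -> c != 0 ->
  p != 0 -> ldf l u p = p -> N != 0 -> ldf l u N = N ->
  D != 0 -> ldf l u D = D -> N ^+ k = c *: (p * D ^+ k) ->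
  exists2 R, ldf l u R = R & p = R ^+ k.
Proof.
move=> u0 k0 c0 p0 hp N0 hN D0 hD NE.
have [w w0 line] := level_line l_gt0 u0.
have [e1 [f1 [f10 E1]]] := homog_ray w0 line N0 hN.
have [e2 [f2 [f20 E2]]] := homog_ray w0 line D0 hD.
have [e3 [f3 [f30 E3]]] := homog_ray w0 line p0 hp.
have powc (f : {poly K}) : (f ^+ k)`_0 = f`_0 ^+ k.
  by rewrite -!horner_coef0 horner_exp.
pose g : {poly K} := f3 * f2 ^+ k.
have [] := @ray_inj _ L w w0 (mulexp k e1) (f1 ^+ k)
    (expD e3 (mulexp k e2)) (c *: g).
- by rewrite powc expf_neq0.
- by rewrite coefZ mulf_neq0 // coef0M powc mulf_neq0 ?expf_neq0.
- by rewrite rayZ -rayM -!rayX -E1 -E2 -E3.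
move=> eE fE.
have f2n : f2 != 0 by apply: contraNneq f20 => ->; rewrite coef0.
have : (f2 %| f1)%R.
  rewrite -(dvdp_pexp2r _ _ k0) fE /g dvdpZr // dvdp_mull //.
case/dvdpP => h hE.
have hk : h ^+ k = c *: f3.
  apply: (mulIf (expf_neq0 k f2n)).
  by rewrite -exprMn -hE fE /g scalerAl.
have [z zk] := rootK k c^-1 k0.
case: eE; rewrite /mulexp /expD /= => eE1 eE2.
(* The truncated subtraction is exact, because k e1.2 = e3.2 + k e2.2; so the quotient has no
   negative power of y. *)
pose e := (e1.1 - e2.1, (e1.2 - e2.2)%N).
have e21 : (e2.2 <= e1.2)%N by rewrite -(leq_pmul2l k0) eE2 leq_addl.
pose R0 := ray L w e h.
have NR : N = R0 * D.
  rewrite E1 E2 /R0 rayM -hE; congr ray.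
  by rewrite /expD /e /= subrK subnK // -surjective_pairing.
have R00 : R0 != 0.
  by apply: contraNneq N0 => R00; rewrite NR R00 mul0r.
have hR0 : ldf l u R0 = R0.
  apply: (mul_cancel l_gt0 D0); rewrite ![D * _]mulrC -NR -[in RHS]hN NR.
  by rewrite (ldfM l_gt0) // hD.
have z0 : z != 0.
  apply: contraNneq (invr_neq0 c0) => z0.
  by rewrite -zk z0 expr0n gtn_eqF.
exists (z *: R0).
  have [] // := @homogP _ L l u (deg l u R0) (z *: R0).
    by rewrite -mulr_algl (mul_neq0 l_gt0) // scaler_eq0 negb_or z0 oner_neq0.
  move=> e'; rewrite mem_supp coef_scale mulf_eq0 negb_or => /andP[_].
  by rewrite -mem_supp; exact: wt_homog.
rewrite exprZn rayX hk rayZ zk scalerA mulVf // scale1r E3; congr ray.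
rewrite /mulexp /e [e3 in LHS]surjective_pairing /=; congr pair.
  by rewrite mulrBr eE1 addrK.
by rewrite mulnBr eE2 addnK.
Qed.

(** * Arcs of directions *)

Section Arcs.
Implicit Types A B u v w : rat * rat.

Definition upperq A u : bool :=
  (0 < cross A u) || (cross A u == 0) && (0 < dot A u).

(* The rational counterpart of ccw_le. *)
Definition ccwq A u v : bool :=
  if upperq A u == upperq A v then 0 <= cross u v else upperq A u.

Lemma cross_r0 u : cross u (0, 0) = 0.
Proof. by rewrite /cross /= !mulr0 subrr. Qed.

Lemma dot_gt0 u : u != (0, 0) -> 0 < dot u u.
Proof.
case: u => x y; rewrite xpair_eqE negb_and /dot /= => /orP[]/eqP h; nra.
Qed.

Lemma cross_frame A u v :
  dot A A * cross u v = dot A u * cross A v - cross A u * dot A v.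
Proof. by rewrite /dot /cross; ring. Qed.

Lemma frame_neq0 A u : u != (0, 0) -> A != (0, 0) ->
  (cross A u != 0) || (dot A u != 0).
Proof.
move=> /dot_gt0 u0 /dot_gt0 A0; rewrite -negb_and;
  apply/negP => /andP[/eqP c /eqP d].
have : dot A A * dot u u = dot A u ^+ 2 + cross A u ^+ 2.
  by rewrite /dot /cross; ring.
by rewrite c d; nra.
Qed.

(** In the orthogonal frame of A every vector is described by its cross and dot products with A, and
    the claim becomes a sign analysis of these coordinates. *)
Lemma ccwq_trans A u v w : A != (0, 0) -> v != (0, 0) ->
  ccwq A u v -> ccwq A v w -> ccwq A u w.
Proof.
move=> A0 v0.
have cE x y : (0 <= cross x y) =
  (0 <= dot A x * cross A y - cross A x * dot A y).
  by rewrite -cross_frame pmulr_rge0 // dot_gt0.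
rewrite /ccwq !cE /upperq; have := frame_neq0 v0 A0.
move: (cross A u) (cross A v) (cross A w) (dot A u) (dot A v) (dot A w).
move=> x1 x2 x3 d1 d2 d3 nz.
by case: (ltrgt0P x1) => h1; case: (ltrgt0P x2) => h2 //=; rewrite ?h1 ?h2;
  case: (ltP 0 d1) => k1 //=; case: (ltP 0 d2) => k2 //=;
  case: (ltrgt0P x3) => h3 //=; rewrite ?h3 //=;
  case: (ltP 0 d3) => k3 //=; move: nz; rewrite ?h2 ?eqxx //=; nra.
Qed.

Lemma upperq_refl A : A != (0, 0) -> upperq A A.
Proof.
move=> /dot_gt0 A0; rewrite /upperq A0 andbT.
by rewrite (_ : cross A A = 0) ?eqxx ?orbT // /cross; ring.
Qed.

Lemma ccwq_first A w : A != (0, 0) -> ccwq A A w.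
Proof.
move=> A0; rewrite /ccwq upperq_refl //; case: ifP => // /eqP/esym.
by case/orP => [/ltW|/andP[/eqP->]].
Qed.

Variables A B : rat * rat.
Hypothesis A_gt0 : 0 < A.1 + A.2.
Hypothesis B_lt : ~~ ccwq A (0, -1) B.

(** The arc ]A, B]: as A comes first in the order, the middle clause removes exactly the ray of
    A. *)
Definition dir_arc u : Prop := [/\ u != (0, 0), ~~ ccwq A u A & ccwq A u B].

Lemma A_neq0 : A != (0, 0).
Proof. by apply: contraTneq A_gt0 => ->; rewrite addr0 ltxx. Qed.

Lemma upper_ray u : cross A u = 0 -> 0 < dot A u -> 0 < u.1 + u.2.
Proof.
move=> c d; have AA := dot_gt0 A_neq0.
have : dot A A * (u.1 + u.2) = dot A u * (A.1 + A.2) + cross A u * (A.1 - A.2).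
  by rewrite /dot /cross; ring.
rewrite c mul0r addr0 => E.
by rewrite -(pmulr_rgt0 _ AA) E mulr_gt0.
Qed.

(** Both -A and (0, -1) lie in the open half-plane x + y < 0, hence so does the part of the arc from
    -A on, which ends before (0, -1). *)
Lemma arc_sum_lt0 u : dir_arc u -> cross A u <= 0 -> u.1 + u.2 < 0.
Proof.
move=> [u0 uA uB] cu; have up := upperq_refl A_neq0.
have := contra (ccwq_trans A_neq0 u0 ^~ uB) B_lt => lowu.
have uu : upperq A u = false.
  apply/negP => uu; case/negP: uA; rewrite /ccwq up uu eqxx.
  by move: cu; rewrite /cross; lra.
have c1 : cross A (0, -1) = - A.1 by rewrite /cross /=; ring.
have e1 : (cross A (0, -1) == 0) = (A.1 == 0) by rewrite c1 (oppr_eq0 A.1).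
have d1 : dot A (0, -1) = - A.2 by rewrite /dot /=; ring.
have c2 : cross (0, -1) u = u.1 by rewrite /cross /=; ring.
move: lowu; rewrite /ccwq uu /upperq e1 c1 d1 c2 !oppr_gt0.
move: A_gt0 cu; rewrite /cross; move: (A.1) (A.2) (u.1) (u.2) => x y z t.
case: (ltrgt0P x) => hx //= xy cu.
  by rewrite -ltNge => z0; nra.
have y0 : y < 0 = false by apply/negbTE; rewrite -leNgt; lra.
by rewrite y0 eqxx -ltNge => z0; nra.
Qed.

Lemma arc_chord v t : 0 < cross A v -> ccwq A v B -> 0 < t <= 1 ->
  dir_arc (line A (v - A) t).
Proof.
move=> cv vB /andP[t0 t1]; have up := upperq_refl A_neq0.
set x := line _ _ _.
have cx : cross A x = t * cross A v by rewrite /x /line /cross /=; ring.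
have cxv : cross x v = (1 - t) * cross A v by rewrite /x /line /cross /=; ring.
have cx0 : 0 < cross A x by rewrite cx mulr_gt0.
have ux : upperq A x by rewrite /upperq cx0.
have uv : upperq A v by rewrite /upperq cv.
split.
- by apply: contraTneq cx0 => ->; rewrite cross_r0 ltxx.
- rewrite /ccwq ux up eqxx -ltNge.
  by have -> : cross x A = - cross A x; [rewrite /cross;
    ring | rewrite oppr_lt0].
apply: (@ccwq_trans A x v B A_neq0) => //.
  by apply: contraTneq cv => ->; rewrite cross_r0 ltxx.
by rewrite /ccwq ux uv eqxx cxv; apply: mulr_ge0; [lra | exact: ltW].
Qed.

(* If u is at least half a turn away from A, then (-1, 1) lies between A and u,
   at an angle smaller than a half turn from both. *)
Lemma arc_mid u : dir_arc u -> cross A u <= 0 ->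
  0 < cross A (-1, 1) /\ ccwq A (-1, 1) B.
Proof.
move=> au cu; have su := arc_sum_lt0 au cu; have [u0 uA uB] := au.
have cm : 0 < cross A (-1, 1).
  by have -> : cross A (-1, 1) = A.1 + A.2 by rewrite /cross /=; ring.
split=> //; apply: (@ccwq_trans A _ u B A_neq0 u0) => //.
have um : upperq A (-1, 1) by rewrite /upperq cm.
rewrite /ccwq um; case: ifP => // _.
by rewrite /cross /=; lra.
Qed.

(** The coordinate sum is nonpositive along this chord, so it cannot return to the ray of A, where
    the sum is positive. *)
Lemma arc_chord_mid u t : dir_arc u -> cross A u <= 0 -> 0 <= t <= 1 ->
  dir_arc (line (-1, 1) (u - (-1, 1)) t).
Proof.
move=> au cu /andP[t0 t1]; have su := arc_sum_lt0 au cu.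
have [u0 uA uB] := au; have [cm mB] := arc_mid au cu.
have up := upperq_refl A_neq0.
set m : rat * rat := (-1, 1); set x := line _ _ _.
have sx : x.1 + x.2 = t * (u.1 + u.2) by rewrite /x /line /m /=; ring.
have cmu : 0 < cross m u by rewrite /cross /=; lra.
have cxu : cross x u = (1 - t) * cross m u by rewrite /x /line /cross /m /=;
  ring.
have cmx : cross m x = t * cross m u by rewrite /x /line /cross /m /=; ring.
have uu : upperq A u = false.
  apply/negP => /orP[|/andP[/eqP c d]]; first by rewrite ltNge cu.
  by have := upper_ray c d; lra.
split.
- have [t00|tn0] := eqVneq t 0; first by rewrite /x t00 line0.
  have : 0 < cross m x by rewrite cmx mulr_gt0 // lt_neqAle eq_sym tn0.
  by apply: contraTneq => ->; rewrite cross_r0 ltxx.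
- rewrite /ccwq up; case ux: (upperq A x) => //=; rewrite -ltNge.
  have -> : cross x A = - cross A x by rewrite /cross; ring.
  rewrite oppr_lt0; case/orP: ux => // /andP[/eqP c d].
  by have := upper_ray c d; rewrite sx; nra.
apply: (@ccwq_trans A x u B A_neq0) => //.
rewrite /ccwq uu cxu; case: ifP => [_|/negbT]; last by case: (upperq A x).
by apply: mulr_ge0; [lra | exact: ltW].
Qed.

End Arcs.

Lemma ccwq_dirq (A u v : int * int) :
  ccwq (dirq A) (dirq u) (dirq v) = ccw_le A u v.
Proof.
have cE (x y : int * int) : cross (dirq x) (dirq y) = (cross x y)%:~R.
  by rewrite /cross /dirq /= rmorphB !rmorphM.
have dE (x y : int * int) : dot (dirq x) (dirq y) = (dot x y)%:~R.
  by rewrite /dot /dirq /= rmorphD !rmorphM.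
by rewrite /ccwq /ccw_le /upperq /upper_half !cE !dE !ltr0z !ler0z !intr_eq0.
Qed.

Definition scalep (c : rat) (u : rat * rat) : rat * rat := (c * u.1, c * u.2).

Lemma upperq_scale A u c : 0 < c -> upperq A (scalep c u) = upperq A u.
Proof.
move=> c0; have -> : upperq A (scalep c u) =
    (0 < c * cross A u) || (c * cross A u == 0) && (0 < c * dot A u).
  rewrite /upperq /cross /dot /=.
  by congr (_ || _ && _); [congr (_ < _)|congr (_ == _)|congr (_ < _)]; ring.
by rewrite !pmulr_rgt0 // mulf_eq0 gt_eqF.
Qed.

Lemma ccwq_scale A u v c : 0 < c ->
  (ccwq A (scalep c u) v = ccwq A u v) * (ccwq A u (scalep c v) = ccwq A u v).
Proof.
move=> c0; rewrite /ccwq !upperq_scale //.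
have -> : cross (scalep c u) v = c * cross u v by rewrite /cross /=; ring.
have -> : cross u (scalep c v) = c * cross u v by rewrite /cross /=; ring.
by rewrite !pmulr_rge0.
Qed.

Lemma rat_direction u : u != (0, 0) :> rat * rat -> exists c (w : int * int),
  [/\ 0 < c, is_dir w & u = scalep c (dirq w)].
Proof.
case: u => x y u0.
pose N := denq x * denq y; pose a := numq x * denq y; pose b := numq y * denq x.
have N0 : 0 < N by rewrite mulr_gt0 ?denq_gt0.
have ex : N%:~R * x = a%:~R.
  rewrite /N /a !rmorphM /= -{2}(divq_num_den x); field.
  by rewrite intr_eq0 denq_neq0.
have ey : N%:~R * y = b%:~R.
  rewrite /N /b !rmorphM /= -{2}(divq_num_den y); field.
  by rewrite intr_eq0 denq_neq0.
have g0 : gcdz a b != 0.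
  rewrite gcdz_eq0; apply: contraNN u0 => /andP[/eqP a0 /eqP b0].
  move: ex ey; rewrite a0 b0 => /eqP + /eqP.
  by rewrite !mulf_eq0 intr_eq0 gt_eqF //= => /eqP-> /eqP->.
have gge : 0 <= gcdz a b by [].
have gpos : 0 < gcdz a b by rewrite lt_neqAle eq_sym g0.
have /dvdzP[a' aE] := dvdz_gcdl a b; have /dvdzP[b' bE] := dvdz_gcdr a b.
exists ((gcdz a b)%:~R / N%:~R), (a', b'); split.
- by rewrite divr_gt0 // ltr0z.
- rewrite /is_dir /=; have := mulz_gcdl a' b' (gcdz a b).
  rewrite -aE -bE gez0_abs // -[RHS]mul1r => /(mulIf g0) ->.
  by rewrite eqxx.
rewrite /scalep /dirq /=; congr pair.
  rewrite mulrAC -rmorphM /= [_ * a']mulrC -aE -ex; field.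
  by rewrite intr_eq0 gt_eqF.
rewrite mulrAC -rmorphM /= [_ * b']mulrC -bE -ey; field.
by rewrite intr_eq0 gt_eqF.
Qed.

Lemma dirq_neq0 (d : int * int) : is_dir d -> dirq d != (0, 0).
Proof.
apply: contraTneq => -[/eqP + /eqP]; rewrite !intr_eq0 /is_dir.
by move=> /eqP-> /eqP->.
Qed.

Lemma eq_scalep (x e : rat * rat) (k : rat) : k != 0 ->
  (x.1 / k, x.2 / k) = e -> x = scalep k e.
Proof.
move=> k0 <-; rewrite /scalep /= !(mulrC k) !divfK //.
exact: surjective_pairing.
Qed.

Lemma line1 u v : line u (v - u) 1 = v.
Proof.
by case: u v => [a b] [c d]; rewrite /line /=; congr pair; ring.
Qed.

(** * Propagation along the arc *)

Section Main.
Variables (K : fieldType) (L : laurent_model K) (l : nat).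
Hypotheses (l_gt0 : (0 < l)%N) (charK : [pchar K] =i pred0).
Implicit Types (G H : L) (e : int * nat) (u v w : rat * rat).
Local Notation wt := (weight l).
Local Notation deg := (deg l).
Local Notation ldf := (ldf l).

Definition XY : L := mono L 1 (l%:Z, 1%N).

Lemma XY_neq0 : XY != 0.
Proof.
by apply: (@supp_neq0 _ _ _ (l%:Z, 1%N));
  rewrite mem_supp coef_mono eqxx oner_neq0.
Qed.

Lemma deg_XY u : deg u XY = u.1 + u.2.
Proof.
rewrite deg_mono ?oner_neq0 // /weight /dot /pt /= -pmulrn divff ?mulr1 //.
by rewrite pnatr_eq0 -lt0n.
Qed.

Lemma ldf_XY u : ldf u XY = XY.
Proof.
have [] // := @homogP _ L l u (u.1 + u.2) XY XY_neq0.
by move=> e /mem_supp_mono ->; rewrite -deg_XY /XY deg_mono ?oner_neq0.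
Qed.

Lemma ldfZ u c G : c != 0 -> ldf u (c *: G) = c *: ldf u G.
Proof.
move=> c0; apply: coef_ext => e;
  rewrite coef_scale !coef_ldf degZ // coef_scale.
by case: ifP; rewrite ?mulr0.
Qed.

(** On the segment from st to en the A-weight is constant, and for w counterclockwise of A the
    w-weight is largest at en. *)
Lemma is_en_deg (A : rat * rat) G (s0 e0 : int * nat) :
  s0 \in supp (ldf A G) -> e0 \in supp (ldf A G) ->
  (forall f, f \in supp (ldf A G) -> in_segment (pt l s0) (pt l e0) (pt l f)) ->
  (pt l s0 != pt l e0 -> 0 < cross A (pt l e0 - pt l s0)) ->
  forall w x, 0 < cross A w -> 0 <= x ->
  deg (line A w x) (ldf A G) = dot (line A w x) (pt l e0).
Proof.
move=> s0G e0G seg orient w x cw x0; apply: deg_eq => // f fG.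
have [t [/andP[t0 t1] f1 f2]] := seg f fG.
have : dot A (pt l s0) = dot A (pt l e0).
  rewrite -[dot _ _]/(wt A s0) -[RHS]/(wt A e0).
  by move: s0G e0G; rewrite !supp_ldf => /andP[_ /eqP ->] /andP[_ /eqP ->].
rewrite !wt_line /weight.
have [es|/orient] := eqVneq (pt l s0) (pt l e0).
  move=> _; have -> : pt l f = pt l e0; last by [].
  rewrite [pt l f]surjective_pairing f1 f2 es !subrr !mulr0 !addr0.
  by rewrite -surjective_pairing.
have -> : dot A (pt l f) =
  dot A (pt l s0) + t * (dot A (pt l e0) - dot A (pt l s0)).
  by rewrite /dot f1 f2; ring.
have -> : dot w (pt l f) =
  dot w (pt l s0) + t * (dot w (pt l e0) - dot w (pt l s0)).
  by rewrite /dot f1 f2; ring.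
move=> co As; rewrite As subrr mulr0 addr0 lerD2l ler_wpM2l //.
have AA : 0 < dot A A.
  apply: dot_gt0; apply: contraTneq cw => ->.
  by rewrite /cross /= !mul0r subrr ltxx.
have : 0 < dot A A * (dot w (pt l e0) - dot w (pt l s0)).
  have -> : dot A A * (dot w (pt l e0) - dot w (pt l s0)) =
     dot A w * (dot A (pt l e0) - dot A (pt l s0))
     + cross A w * cross A (pt l e0 - pt l s0).
    by rewrite /dot /cross /=; ring.
  by rewrite As subrr mulr0 add0r mulr_gt0.
rewrite (pmulr_rgt0 _ AA) => D.
have := mulr_ge0 (_ : 0 <= 1 - t) (ltW D); rewrite subr_ge0 => /(_ t1).
by lra.
Qed.

Variables (A B : rat * rat) (P : L).
Hypotheses (A_gt0 : 0 < A.1 + A.2) (B_lt : ~~ ccwq A (0, -1) B).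
Hypotheses (P_neq0 : P != 0) (posA : 0 < deg A P).
Hypothesis pos : forall u, dir_arc A B u -> 0 < deg u P.

(** One chord from A suffices before the half turn. Otherwise the ratio is first carried to (-1, 1),
    where it gives commutation and hence a germ for the second chord. *)
Lemma arc_ratio G r : G != 0 ->
  (forall w, 0 < cross A w -> exists2 t, 0 < t &
     forall x, 0 <= x <= t -> deg (line A w x) G = r * deg (line A w x) P) ->
  (forall u, dir_arc A B u -> deg u G = r * deg u P ->
    logbr (ldf u G) (ldf u P) = 0) ->
  forall u, dir_arc A B u -> deg u G = r * deg u P.
Proof.
move=> G0 start comm.
have chord v : 0 < cross A v -> ccwq A v B -> deg v G = r * deg v P.
  move=> cv vB; rewrite -(line1 A v).
  apply: (@ratio_segment _ L l l_gt0 charK) => //.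
  - move=> t /andP[t0 t1]; have [->|tn0] := eqVneq t 0.
      by rewrite line0 gt_eqF.
    have tp : 0 < t <= 1 by rewrite lt_neqAle eq_sym tn0 t0.
    by rewrite gt_eqF // pos //; exact: arc_chord.
  - by move=> t t01 rt; apply: comm => //; exact: arc_chord.
  - apply: start.
    have -> : cross A (v - A) = cross A v by rewrite /cross /=; ring.
    by [].
move=> u au; have [cu|cu] := ltrP 0 (cross A u).
  by case: au => _ _; exact: chord.
have [cm mB] := arc_mid A_gt0 B_lt au cu; have rm := chord _ cm mB.
have am := arc_chord_mid A_gt0 B_lt au cu.
have am0 : dir_arc A B (-1, 1).
  by rewrite -(line0 (-1, 1) (u - (-1, 1))); apply: am; rewrite lexx ler01.
rewrite -(line1 (-1, 1) u); apply: (@ratio_segment _ L l l_gt0 charK) => //.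
- by move=> t t01; rewrite gt_eqF // pos //; exact: am.
- move=> t /andP[t0 t1] rt; apply: comm => //; apply: am.
  by rewrite (ltW t0).
- apply: (@ratio_germ _ L l l_gt0 charK) => //; first by rewrite gt_eqF // pos.
  exact: comm.
Qed.

(** * Bracketing with P: [br G] stands for [G, P], with c = 1/l *)

Variables (br : L -> L) (c : K).
Hypotheses (c_neq0 : c != 0) (brE : forall G, XY * br G = c *: logbr G P).

Lemma br_eq0 G : (br G == 0) = (logbr G P == 0).
Proof.
have := brE G; have [->|b0] := eqVneq (br G) 0.
  by rewrite mulr0 => /esym/eqP; rewrite scaler_eq0 (negPf c_neq0) /= => ->.
move=> E; have := mul_neq0 l_gt0 XY_neq0 b0.
by rewrite E scaler_eq0 (negPf c_neq0) /= => /negPf ->.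
Qed.

Lemma deg_br u G : br G != 0 -> u.1 + u.2 + deg u (br G) = deg u (logbr G P).
Proof.
move=> b0; rewrite -deg_XY -(degM l_gt0) ?XY_neq0 // brE degZ //.
Qed.

(** Here r' is the ratio of [br G]; failure to commute would force u.1 + u.2 = (r + 1 - r') deg u
    P. *)
Lemma commute_leading u G r r' : deg u G = r * deg u P ->
  (br G != 0 -> deg u (br G) = r' * deg u P) ->
  (br G != 0 -> u.1 + u.2 < (r + 1 - r') * deg u P) ->
    logbr (ldf u G) (ldf u P) = 0.
Proof.
move=> dG dbr lt; apply/eqP; apply/negPn/negP => /logbr_leading[B0 dB _].
have b0 : br G != 0 by rewrite br_eq0.
by have := deg_br u b0; rewrite dB dbr // dG; have := lt b0; lra.
Qed.

Variable kap : rat.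
Hypothesis kapA : A.1 + A.2 = kap * deg A P.
Hypothesis kap_lt : forall u, dir_arc A B u -> u.1 + u.2 < kap * deg u P.

Lemma iter_br_ratio k G : G != 0 -> iter k br G = 0 ->
  (forall i, logbr (ldf A (iter i br G)) (ldf A P) = 0) ->
  forall u, dir_arc A B u -> deg u G = deg A G / deg A P * deg u P /\
    logbr (ldf u G) (ldf u P) = 0.
Proof.
have A0 := gt_eqF posA.
elim: k G => [G G0 G0'|k IH G G0]; first by rewrite [G]G0' eqxx in G0.
rewrite iterSr => nil comm; set r := deg A G / deg A P.
have dA : deg A G = r * deg A P by rewrite /r divfK // A0.
have commu u : dir_arc A B u -> deg u G = r * deg u P ->
  logbr (ldf u G) (ldf u P) = 0.
  move=> au ru; apply: (@commute_leading u G r (deg A (br G) / deg A P)) => //.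
    move=> b0; have [] // := IH (br G) b0 nil _ u au.
    by move=> i; rewrite -iterSr; exact: comm i.+1.
  (* At A the degree of the bracket is at most the sum of the degrees, that is, kap <= r + 1 - r';
     beyond A the strictness comes from [kap_lt]. *)
  move=> b0; apply: lt_le_trans (kap_lt au) _; rewrite ler_pM2r ?pos //.
  have : logbr G P != 0 by rewrite -br_eq0.
  move/(deg_logbr_le l A); rewrite -deg_br // kapA dA.
  rewrite -(ler_pM2r posA).
  have dbr : deg A (br G) / deg A P * deg A P =
    deg A (br G) by rewrite divfK ?A0.
  by lra.
suff R : forall u, dir_arc A B u -> deg u G = r * deg u P by move=> u au; auto.
apply: arc_ratio => // w cw.
by apply: (@ratio_germ _ L l l_gt0 charK) => //; [rewrite A0 | exact: comm 0%N].
Qed.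

End Main.

(* The degrees of quotients of homogeneous elements commuting with p form a
   group, so a Bezout combination realises deg p / k; normality of the ring
   then makes p a k-th power. *)
Section PowerExtraction.
Variables (K : fieldType) (L : laurent_model K) (l : nat).
Hypotheses (l_gt0 : (0 < l)%N) (charK : [pchar K] =i pred0).
Hypothesis rootK : forall (k : nat) (c : K), (0 < k)%N -> exists z, z ^+ k = c.
Variables (u : rat * rat) (P : L).
Hypotheses (u_neq0 : u != (0, 0)) (P_neq0 : P != 0) (deg_gt0 : 0 < deg l u P).

Definition commutant (G : L) : Prop :=
  [/\ G != 0, ldf l u G = G & logbr G (ldf l u P) = 0].

Lemma commutantM G H : commutant G -> commutant H -> commutant (G * H).
Proof.
move=> [G0 hG cG] [H0 hH cH]; split; first exact: (mul_neq0 l_gt0).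
  by rewrite (ldfM l_gt0) // hG hH.
exact: logbrM0.
Qed.

Lemma commutantX G k : commutant G -> commutant (G ^+ k).
Proof.
move=> [G0 hG cG]; split; first exact: (exp_neq0 l_gt0).
  by rewrite (ldfX l_gt0).
exact: logbrX.
Qed.

Lemma commutant1 : commutant 1.
Proof.
split; first exact: oner_neq0.
  by rewrite -(expr0 (ldf l u P)) (ldfX l_gt0) ?ldf_neq0 // ldf_id.
by rewrite -(expr0 (ldf l u P)) logbrX // logbr_xx.
Qed.

Variable k : nat.
Hypothesis k_gt0 : (0 < k)%N.

Definition attained (s : int) : Prop := exists N D,
  [/\ commutant N, commutant D
    & deg l u N = deg l u D + s%:~R * (deg l u P / k%:R)].

Lemma attainedB s t : attained s -> attained t -> attained (s - t).
Proof.
move=> [N1 [D1 [n1 d1 e1]]] [N2 [D2 [n2 d2 e2]]].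
exists (N1 * D2), (D1 * N2); split; try exact: commutantM.
move: n1 d1 n2 d2 => [? _ _] [? _ _] [? _ _] [? _ _].
by rewrite !(degM l_gt0) // e1 e2 rmorphB /=; ring.
Qed.

Lemma attained0 : attained 0.
Proof. by exists 1, 1; split; try exact: commutant1; rewrite mul0r addr0. Qed.

Lemma attainedN s : attained s -> attained (- s).
Proof. by move=> /(attainedB attained0); rewrite sub0r. Qed.

Lemma attainedD s t : attained s -> attained t -> attained (s + t).
Proof. by move=> hs /attainedN /(attainedB hs); rewrite opprK. Qed.

Lemma attainedM z s : attained s -> attained (z * s).
Proof.
move=> hs; have nat_case (i : nat) : attained (i%:Z * s).
  elim: i => [|i IH]; first by rewrite mul0r; exact: attained0.
  by rewrite intS mulrDl mul1r; exact: attainedD.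
case: z => i; first exact: nat_case.
by rewrite NegzE mulNr; exact/attainedN/nat_case.
Qed.

(** Given N / D of degree deg u P / k, the elements N^k and l_u(P) D^k commute with l_u(P) and have
    equal degree, hence are proportional. *)
Lemma attained_root : attained 1 ->
  exists2 R, ldf l u R = R & ldf l u P = R ^+ k.
Proof.
move=> [N [D [cN cD dND]]]; have [[N0 hN _] [D0 hD _]] := (cN, cD).
have cP : commutant (ldf l u P).
  by split; rewrite ?ldf_neq0 ?ldf_id ?logbr_xx.
have [A10 hA1 cA1] := commutantX k cN.
have [A20 hA2 cA2] := commutantM cP (commutantX k cD).
have [p0 hp _] := cP.
have [||c c0 E] := @centralizer_line _ _ _ l_gt0 charK u (ldf l u P) _ _ p0 hp
   _ A10 hA1 cA1 A20 hA2 cA2.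
- by rewrite deg_ldf // gt_eqF.
- rewrite (degM l_gt0) ?(exp_neq0 l_gt0) // !(degX l_gt0) // dND deg_ldf //
    mul1r.
  by rewrite mulrDr [X in _ + X]mulrC divfK 1?addrC // pnatr_eq0 -lt0n.
exact: (@homog_root _ _ _ rootK l_gt0 u k _ N D c).
Qed.

End PowerExtraction.

(** * The power theorem in a monomial algebra *)

Section Corollary.
Variables (K : fieldType) (L : laurent_model K) (l : nat).
Hypotheses (l_gt0 : (0 < l)%N) (charK : [pchar K] =i pred0).
Hypothesis rootK : forall (k : nat) (c : K), (0 < k)%N -> exists z, z ^+ k = c.
Local Notation deg := (deg l).
Local Notation ldf := (ldf l).

(** Records the end point only through the degrees it produces at A and counterclockwise of A, which
    is all that propagation uses. *)
Definition en_at (A : rat * rat) (G : L) (e : rat * rat) : Prop :=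
  forall w x, 0 < cross A w -> 0 <= x ->
    deg (line A w x) (ldf A G) = dot (line A w x) e.

Lemma en_at_deg A G e :
  A != (0, 0) -> G != 0 -> en_at A G e -> deg A G = dot A e.
Proof.
move=> A0 G0 /(_ (- A.2, A.1) 0); rewrite line0 deg_ldf //; apply=> //.
have -> : cross A (- A.2, A.1) = dot A A by rewrite /cross /dot /=; ring.
exact: dot_gt0.
Qed.

Lemma dot_scalep u s e : dot u (scalep s e) = s * dot u e.
Proof. by rewrite /dot /=; ring. Qed.

(** P and F end at positive multiples of the same vector, so their degrees at A have the same
    sign. *)
Lemma en_at_sum_gt0 A P F s t e : A != (0, 0) -> P != 0 -> F != 0 ->
  0 < s -> 0 < t -> en_at A P (scalep s e) -> en_at A F (scalep t e) ->
  0 < deg A P -> deg A F = A.1 + A.2 -> 0 < A.1 + A.2.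
Proof.
move=> A0 P0 F0 s0 t0 /(en_at_deg A0 P0) -> /(en_at_deg A0 F0) dF.
rewrite dot_scalep pmulr_rgt0 // => pos.
by move=> <-; rewrite dF dot_scalep mulr_gt0.
Qed.

Theorem leading_form_power (A B e : rat * rat) (P Q F G : L) (br :
  L -> L) (c : K)
    (m n p q : nat) :
  0 < A.1 + A.2 -> ~~ ccwq A (0, -1) B ->
  P != 0 -> Q != 0 -> F != 0 -> G != 0 -> 0 < deg A P ->
  (forall u, dir_arc A B u -> 0 < deg u P) ->
  (0 < m)%N -> (0 < n)%N -> (0 < p)%N -> (0 < q)%N -> coprime m n ->
    coprime p q ->
  en_at A P (scalep m%:R e) -> en_at A Q (scalep n%:R e) ->
  en_at A F (scalep (p%:R / q%:R) e) ->
  (forall u, m%:R * dot u e <= deg u P) -> e.1 < e.2 ->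
  c != 0 -> (forall H, XY L l * br H = c *: logbr H P) ->
  br Q != 0 -> (forall u, deg u (br Q) = 0) ->
  ldf A F = F -> deg A F = A.1 + A.2 ->
  c *: logbr (ldf A G) (ldf A P) * F = XY L l * (ldf A G * ldf A P) ->
  (forall i, (0 < i)%N -> logbr (ldf A (iter i br G)) (ldf A P) = 0) ->
  (exists k, iter k br G = 0) ->
  forall u, dir_arc A B u ->
    exists2 R, ldf u R = R & ldf u P = R ^+ (q * m).
Proof.
move=> A_gt0 B_lt P0 Q0 F0 G0 posA pos m0 n0 p0 q0 mn pq enP enQ enF supP e12.
move=> c0 brE brQ0 brQ hF dF brG brGi [k nil].
have A0 : A != (0, 0) := A_neq0 A_gt0.
have mR : 0 < m%:R :> rat by rewrite ltr0n.
have qR : 0 < q%:R :> rat by rewrite ltr0n.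
have [mn0 qn0] : m%:R != 0 :> rat /\ q%:R != 0 :> rat by rewrite !gt_eqF.
have dP := en_at_deg A0 P0 enP; rewrite dot_scalep in dP.
have dQ := en_at_deg A0 Q0 enQ; rewrite dot_scalep in dQ.
have dF' := en_at_deg A0 F0 enF; rewrite dot_scalep dF in dF'.
(* The ratio of the degrees of F and P at A, where these end at (p/q) e and m e. *)
pose kap : rat := p%:R / q%:R / m%:R.
have kap0 : 0 < kap by rewrite !divr_gt0 // ltr0n.
have kapA : A.1 + A.2 = kap * deg A P.
  by rewrite dF' dP /kap mulrA divfK.
have Ae : 0 < dot A e by rewrite -(pmulr_rgt0 _ mR) -dP.
have kap_lt u : dir_arc A B u -> u.1 + u.2 < kap * deg u P.
  move=> au; have du := pos u au; have kd := mulr_gt0 kap0 du.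
  have [su|su] := ltrP (u.1 + u.2) 0; first exact: lt_trans su kd.
  have cu : 0 < cross A u.
    rewrite ltNge; apply/negP => /(arc_sum_lt0 A_gt0 B_lt au).
    by rewrite ltNge su.
  (* Compares (u.1 + u.2) / dot u e with its value at A: it has dropped, because e.1 < e.2. The
     bound m (dot u e) <= deg u P then replaces the end point by P. *)
  have E : (A.1 + A.2) * dot u e - (u.1 + u.2) * dot A e =
    cross A u * (e.2 - e.1).
    by rewrite /dot /cross; ring.
  have : 0 < cross A u * (e.2 - e.1) by rewrite mulr_gt0 // subr_gt0.
  rewrite -E kapA dP subr_gt0 !mulrA mulrAC (ltr_pM2r Ae) => lt.
  apply: lt_le_trans lt _; rewrite -mulrA ler_pM2l //.
have AP0 : deg A P != 0 by rewrite gt_eqF.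
have ratQ u : dir_arc A B u -> deg u Q = n%:R / m%:R * deg u P /\
    logbr (ldf u Q) (ldf u P) = 0.
  have dQP : deg A Q = n%:R / m%:R * deg A P.
    by rewrite dQ dP mulrA divfK.
  have comm v : dir_arc A B v -> deg v Q = n%:R / m%:R * deg v P ->
      logbr (ldf v Q) (ldf v P) = 0.
    (* [Q, P] has degree 0 in every direction, so its ratio is r' = 0. *)
    move=> av rv; apply: (commute_leading l_gt0 c0 brE (r' := 0) rv) => _.
      by rewrite brQ mul0r.
    apply: lt_le_trans (kap_lt v av) _; rewrite ler_pM2r ?pos // subr0.
    have BQ0 : logbr Q P != 0 by rewrite -(br_eq0 l_gt0 c0 brE).
    have := deg_logbr_le l A BQ0; rewrite -(deg_br l_gt0 c0 brE) // brQ addr0.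
    rewrite kapA dQP -[X in _ <= _ + X]mul1r -mulrDl ler_pM2r //.
  suff R v : dir_arc A B v -> deg v Q = n%:R / m%:R * deg v P by move=> au;
    auto.
  apply: (arc_ratio l_gt0 charK A_gt0 B_lt P0 posA pos Q0) => // w cw.
  (* Near A the degrees of Q and P are those of their end points n e and m e. *)
  have [t1 t10 h1] := deg_germ l A w Q0; have [t2 t20 h2] := deg_germ l A w P0.
  exists (Num.min t1 t2); first by rewrite lt_min t10 t20.
  move=> x /andP[x0]; rewrite le_min => /andP[xt1 xt2].
  rewrite h1 ?x0 // h2 ?x0 // enP // enQ // !dot_scalep.
  by rewrite mulrA divfK.
pose G1 := br G.
have g0 := ldf_neq0 l A G0; have p0' := ldf_neq0 l A P0.
have lbr : logbr (ldf A G) (ldf A P) != 0.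
  apply: contraNneq (mul_neq0 l_gt0 (XY_neq0 L l) (mul_neq0 l_gt0 g0 p0')) => E.
  by rewrite -brG E scaler0 mul0r.
have [B0 dB ldB] := logbr_leading lbr.
have G10 : G1 != 0 by rewrite (br_eq0 l_gt0 c0 brE).
(* The bracket of the leading forms is nonzero, hence it is the leading form of G1, and the
   hypothesis on F becomes a relation between products. *)
have G1F : ldf A G1 * F = ldf A G * ldf A P.
  apply: (mul_cancel l_gt0 (XY_neq0 L l)); rewrite -brG -ldB -ldfZ // -brE.
  by rewrite (ldfM l_gt0) ?XY_neq0 // ldf_XY // mulrA.
have ratG1 := iter_br_ratio l_gt0 charK A_gt0 B_lt P0 posA pos c0 brE kapA
  kap_lt G10.
have nil1 : iter k br G1 = 0.
  have brz : br 0 = 0.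
    apply/eqP; rewrite (br_eq0 l_gt0 c0 brE); apply/eqP.
    by rewrite /logbr !logder0 mul0r mulr0 subrr.
  by rewrite /G1 -iterSr iterS nil brz.
have {}ratG1 := ratG1 _ nil1 _.
set r1 := deg A G1 / deg A P in ratG1.
have commG1 i : logbr (ldf A (iter i br G1)) (ldf A P) = 0.
  by rewrite -iterSr; exact: brGi.
have {}ratG1 := ratG1 commG1.
(* Degrees at A in [G1F] give r1 + kap = r0 + 1. *)
pose r0 := r1 + kap - 1.
have ratG u : dir_arc A B u -> deg u G = r0 * deg u P /\
    logbr (ldf u G) (ldf u P) = 0.
  have comm v : dir_arc A B v -> deg v G = r0 * deg v P ->
      logbr (ldf v G) (ldf v P) = 0.
    move=> av rv; apply: (commute_leading l_gt0 c0 brE (r' := r1) rv) => _.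
      by have [] := ratG1 v av.
    by rewrite (_ : r0 + 1 - r1 = kap) ?kap_lt // /r0; ring.
  suff R v : dir_arc A B v -> deg v G = r0 * deg v P by move=> au; auto.
  apply: (arc_ratio l_gt0 charK A_gt0 B_lt P0 posA pos G0) => // w cw.
  (* Just beyond A the degree of G is obtained from [G1F]: G1 keeps the ratio r1, and F and P are
     governed by their end points, on the same ray. *)
  have [t1 t10 h1] := deg_germ l A w G0; have [t2 t20 h2] := deg_germ l A w P0.
  have [t3 t30 h3] := deg_germ l A w G10.
  have dG1 : deg A G1 = r1 * deg A P by rewrite /r1 divfK.
  have [t4 t40 h4] := ratio_germ l_gt0 charK w G10 P0 AP0 (commG1 0%N) dG1.
  exists (Num.min (Num.min t1 t2) (Num.min t3 t4));
    first by rewrite !lt_min t10 t20 t30.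
  move=> x /andP[x0]; rewrite !le_min => /andP[/andP[xt1 xt2] /andP[xt3 xt4]].
  have := congr1 (deg (line A w x)) G1F.
  rewrite !(degM l_gt0) ?ldf_neq0 // -h1 ?x0 // -h2 ?x0 // -h3 ?x0 // h4 ?x0 //.
  have := enF w x cw x0; rewrite hF => ->; have := enP w x cw x0.
  rewrite -h2 ?x0 // => ->; rewrite !dot_scalep /r0 /kap => E.
  have -> : (r1 + p%:R / q%:R / m%:R - 1) * (m%:R * dot (line A w x) e)
    = r1 * (m%:R * dot (line A w x) e) + p%:R / q%:R * dot (line A w x) e
      - m%:R * dot (line A w x) e by field; rewrite mn0 qn0.
  by rewrite E addrK.
move=> u au; have [u0 _ _] := au; have du := pos u au.
have k0 : (0 < q * m)%N by rewrite muln_gt0 q0.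
suff at1 : attained l u P (q * m)%N 1.
  exact: (attained_root l_gt0 charK rootK u0 P0 du k0 at1).
have [[cq cg] cg1] := (ratQ u au, ratG u au, ratG1 u au).
have comm H : H != 0 -> logbr (ldf u H) (ldf u P) = 0 ->
  commutant l u P (ldf u H).
  by move=> H0 cH; split; rewrite ?ldf_neq0 ?ldf_id.
have kE : (q * m)%:R != 0 :> rat by rewrite pnatr_eq0 -lt0n.
(* In units of deg u P / (q m), the elements P, Q and G / G1 have degrees q m, q n and p - q m,
   whose greatest common divisor is 1. *)
have atP : attained l u P (q * m)%N (q * m)%N%:Z.
  exists (ldf u P), 1; split; [by apply: comm;
    rewrite ?logbr_xx|exact: commutant1|].
  by rewrite deg_ldf // deg1 add0r mulrC divfK.
have atQ : attained l u P (q * m)%N (q * n)%N%:Z.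
  exists (ldf u Q), 1; split; [by apply: comm => //;
    case: cq|exact: commutant1|].
  rewrite deg_ldf // deg1 add0r; have [-> _] := cq.
  by rewrite -pmulrn !natrM; field; rewrite mn0 qn0.
have atG : attained l u P (q * m)%N (p%:Z - (q * m)%N%:Z).
  exists (ldf u G), (ldf u G1); split.
  - by apply: comm => //; case: cg.
  - by apply: comm => //; case: cg1.
  rewrite !deg_ldf //; have [-> _] := cg; have [-> _] := cg1.
  by rewrite rmorphB /= -!pmulrn !natrM /r0 /kap; field; rewrite mn0 qn0.
have atp : attained l u P (q * m)%N p%:Z.
  have := attainedD l_gt0 P0 atG atP; rewrite subrK; apply.
have [x [y xy]] : exists x y : int, x * m%:Z + y * n%:Z = 1.
  by have [x [y E]] := Bezoutz m n; exists x, y; rewrite E /gcdz /=;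
    move/eqP: mn => ->.
have [s [t st]] : exists x y : int, x * p%:Z + y * q%:Z = 1.
  by have [s [t E]] := Bezoutz p q; exists s, t; rewrite E /gcdz /=;
    move/eqP: pq => ->.
have atq : attained l u P (q * m)%N q%:Z.
  have -> : q%:Z = x * (q * m)%N%:Z + y * (q * n)%N%:Z.
    by rewrite !PoszM -[LHS]mulr1 -xy; ring.
  by apply: (attainedD l_gt0 P0); apply: (attainedM l_gt0 P0).
by rewrite -st; apply: (attainedD l_gt0 P0); apply: (attainedM l_gt0 P0).
Qed.

End Corollary.

(** * Laurent polynomials *)

Section Nilpotency.
Variables (R : comNzRingType) (D : R -> R).
Hypotheses (DD : forall x y, D (x + y) = D x + D y)
  (DM : forall x y, D (x * y) = D x * y + x * D y).

Lemma iterD0 k : iter k D 0 = 0.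
Proof.
have D0 : D 0 = 0 by apply: (addrI (D 0)); rewrite -DD !addr0.
by elim: k => //= k ->.
Qed.

Lemma iterDD k x y : iter k D (x + y) = iter k D x + iter k D y.
Proof. by elim: k => //= k ->. Qed.

Lemma nilD x y : (exists k, iter k D x = 0) -> (exists k, iter k D y = 0) ->
  exists k, iter k D (x + y) = 0.
Proof.
move=> [a ha] [b hb]; exists (a + b)%N.
by rewrite iterDD [in X in X + _]addnC !iterD ha hb !iterD0 addr0.
Qed.

(** By the Leibniz rule, applying D once leaves products in which one of the two nilpotency orders
    has dropped; hence induction on their sum. *)
Lemma nilM x y : (exists k, iter k D x = 0) -> (exists k, iter k D y = 0) ->
  exists k, iter k D (x * y) = 0.
Proof.
move=> [a ha] [b hb]; exists (a + b)%N.
have [n] := ubnP (a + b)%N; elim: n => // n IH in a b x y ha hb *.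
case: a ha => [x0 _|a]; first by rewrite (_ : x = 0) // mul0r iterD0.
case: b hb => [y0 _ _|b]; first by rewrite (_ : y = 0) // mulr0 iterD0.
move=> hb ha; rewrite ltnS addSn iterSr DM iterDD => lt.
rewrite (IH a b.+1) //; last by rewrite -iterSr.
by rewrite addnS -addSn (IH a.+1 b) ?addr0 // -?iterSr // addSn -addnS.
Qed.

End Nilpotency.

Section Model.
Variables (K : fieldType) (l : nat).

Lemma laurent_coef_linear (c : K) (P Q : laurent K l) e :
  (c *: P + Q : laurent K l)@_e = c * P@_e + Q@_e.
Proof. by rewrite -mcoeffZ -mcoeffD. Qed.

Definition laurentM : laurent_model K := @LaurentModel K (laurent K l)
  (fun P e => P@_e) (monomial l) (fun P => msupp P : seq _)
  (fun P Q => (malgP P Q).1) laurent_coef_linear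
  (fun c e f => mcoeffU e c f) (@lmulUU K l) erefl
  (fun P => fset_uniq (msupp P)) (fun P e => esym (mcoeff_neq0 P e)).

End Model.

Section BracketDerivation.
Variables (K : fieldType) (L : laurent_model K) (l : nat).
Hypothesis l_gt0 : (0 < l)%N.
Variables (P : L) (br : L -> L) (c : K).
Hypothesis brE : forall G, XY L l * br G = c *: logbr G P.

Lemma br_add G H : br (G + H) = br G + br H.
Proof.
apply: (mul_cancel l_gt0 (XY_neq0 L l)).
by rewrite mulrDr !brE logbrDl scalerDr.
Qed.

Lemma br_mul G H : br (G * H) = br G * H + G * br H.
Proof.
apply: (mul_cancel l_gt0 (XY_neq0 L l)).
rewrite mulrDr mulrA [XY L l * (G * _)]mulrCA !brE logbrMl scalerDr.
by rewrite -scalerAl -scalerAr.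
Qed.

Lemma br_scalar a : br a%:A = 0.
Proof.
apply: (mul_cancel l_gt0 (XY_neq0 L l)); rewrite mulr0 brE.
have T0 chi : chi (0, 0%N) = 0 -> logder chi (a%:A : L) = 0.
  by move=> h; rewrite -mono1 monoZ logder_mono h mul0r mono0.
by rewrite /logbr !T0 /chi1 /chi2 //= mul0r mulr0 subrr scaler0.
Qed.

Lemma br_self : br P = 0.
Proof.
by apply: (mul_cancel l_gt0 (XY_neq0 L l)); rewrite mulr0 brE logbr_xx scaler0.
Qed.

End BracketDerivation.

Section Jacobian.
Variables (K : fieldType) (L : laurent_model K) (l : nat).
Implicit Types P Q : L.

(** [xder] and [yder] copy [dx] and [dy] term by term, so that the concrete bracket is convertible
    to their Jacobian. *)
Definition xder P : L :=
  \sum_(e <- supp P) mono L (e.1%:~R / l%:R * coef P e) (e.1 - l%:Z, e.2).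

Definition yder P : L :=
  \sum_(e <- supp P) mono L (e.2%:R * coef P e) (e.1, e.2.-1).

Lemma X_xder P : mono L 1 (l%:Z, 0%N) * xder P = l%:R^-1 *: logder (@chi1 K) P.
Proof.
rewrite logderE mulr_sumr scaler_sumr; apply: eq_bigr => e _.
rewrite monoM monoZ /expD /= add0n addrC subrK mul1r.
by rewrite [_ / _]mulrC -mulrA -surjective_pairing.
Qed.

Lemma Y_yder P : mono L 1 (0, 1%N) * yder P = logder (@chi2 K) P.
Proof.
rewrite logderE mulr_sumr; apply: eq_bigr => -[i [|j]] _.
  by rewrite monoM /chi2 /= !mul0r mulr0 !mono0.
by rewrite monoM /expD /= add0r mul1r.
Qed.

Lemma XY_jacobian P Q : XY L l * (xder P * yder Q - xder Q * yder P)
  = l%:R^-1 *: logbr P Q.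
Proof.
rewrite /logbr -!Y_yder scalerBr ![l%:R^-1 *: (_ * _)]scalerAl -!X_xder.
have -> : XY L l = mono L 1 (l%:Z, 0%N) * mono L 1 (0, 1%N).
  by rewrite monoM mulr1 /expD /= addr0.
ring.
Qed.

Lemma ldfE u P : ldf l u P =
  \sum_(e <- supp P | weight l u e == deg l u P) mono L (coef P e) e.
Proof.
apply: coef_ext => e; rewrite coef_ldf big_mkcond /=.
rewrite (eq_bigr (fun f =>
  mono L (if weight l u f == deg l u P then coef P f else 0) f)).
  rewrite (coef_sum_mono L (fun f =>
    if weight l u f == deg l u P then coef P f else 0)) ?supp_uniq //.
  by case: (boolP (e \in supp P)) => // /coef_out ->; rewrite if_same.
by move=> f _; case: ifP => // _; rewrite mono0.
Qed.

End Jacobian.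

Section Bridge.
Variables (K : fieldType) (l : nat).
Hypothesis l_gt0 : (0 < l)%N.
Local Notation M := (laurentM K l).
Implicit Types (P Q G : laurent K l) (d : int * int).

Lemma deg_scalep (L : laurent_model K) (x : rat) (u : rat * rat) (H : L) :
  0 < x -> H != 0 ->
  deg l (scalep x u) H = x * deg l u H.
Proof.
move=> x0 H0; have wE e : weight l (scalep x u) e = x * weight l u e.
  by rewrite /weight /dot /=; ring.
have [e eH em] := deg_attained l u H0.
rewrite -em -wE; apply: deg_eq => // f fH.
by rewrite !wE em ler_pM2l // weight_le_deg.
Qed.

Lemma vdegE d P : (P : M) != 0 -> vdeg d P = (deg l (dirq d) (P : M))%:E.
Proof.
move=> P0; have [e eP em] := @deg_attained _ M l (dirq d) P P0.
apply/eqP; rewrite eq_le; apply/andP; split.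
  rewrite /vdeg big_seq; elim/big_ind: _ => //.
  - exact: leNye.
  - by move=> x y hx hy; rewrite ge_max hx hy.
  move=> f fP; rewrite lee_fin; exact: (@weight_le_deg _ M l (dirq d) P f fP).
rewrite -em /vdeg.
exact: (@le_bigmax_seq _ _ _ _ _ e xpredT (fun e => (vexp l d e)%:E) eP isT).
Qed.

Lemma deg_vdeg d P r : (P : M) != 0 -> vdeg d P = r%:E -> deg l (dirq d) (P :
  M) = r.
Proof. by move=> P0; rewrite vdegE // => -[]. Qed.

Lemma leadE d P : lead d P = ldf l (dirq d) (P : M).
Proof.
have [->|P0] := eqVneq (P : M) 0.
  have -> : ldf l (dirq d) (0 : M) = 0 by exact: ldf0.
  rewrite /lead big1_seq // => e /andP[_ e0].
  by have: false by rewrite -(@supp0F _ M e); exact: e0.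
have -> : lead d P = \sum_(e <- msupp P | weight l (dirq d) e == deg l (dirq d)
  (P : M))
    monomial l P@_e e.
  by rewrite /lead vdegE.
exact/esym/(@ldfE _ M l (dirq d) P).
Qed.

Lemma XY_bracket G P : XY M l * (bracket G P : M) = l%:R^-1 *: logbr (G :
  M) (P : M).
Proof. exact: (@XY_jacobian _ M l G P). Qed.

Lemma bracket_mul (G P F H : M) : bracket (G : laurent K l) P * (F :
  laurent K l) = H ->
  l%:R^-1 *: logbr G P * F = XY M l * H.
Proof. by move=> <-; rewrite -XY_bracket -mulrA. Qed.

End Bridge.

Section BridgeHyps.
Variables (K : fieldType) (l : nat).
Hypotheses (l_gt0 : (0 < l)%N) (charK : [pchar K] =i pred0).
Local Notation M := (laurentM K l).
Implicit Types (P Q G : laurent K l) (d : int * int).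

Lemma is_en_at d G e : is_en d G e ->
  [/\ (G : M) != 0, en_at l (dirq d) (G : M) e
    & exists2 e0, e0 \in supp (G : M) & e = pt l e0].
Proof.
move=> [s [/mapP[s0 s0G sE] /mapP[e0 e0G eE] seg orient]].
have suppE : msupp (lead d G) = msupp (ldf l (dirq d) (G : M) : laurent K l).
  by rewrite -leadE.
rewrite suppE in s0G e0G.
have e0G' : e0 \in supp (G : M).
  by have := @supp_ldf _ M l (dirq d) G e0; rewrite [LHS]e0G => /esym/andP[].
split; first exact: (@supp_neq0 _ M G e0 e0G').
  rewrite eE => w x cw x0.
  apply: (@is_en_deg _ M l (dirq d) G s0 e0) => //.
    move=> f fG; rewrite -sE -eE; apply: seg; apply: map_f.
    by rewrite suppE.
  by rewrite -sE -eE.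
by exists e0.
Qed.

(** Positivity is given on primitive integer directions; a nonzero rational vector is a positive
    multiple of one, and degrees scale accordingly. *)
Lemma dir_arc_deg_gt0 P d0 d : (P : M) != 0 -> is_dir d0 -> pos_dir d0 P d ->
  forall u, dir_arc (dirq d0) (dirq d) u -> 0 < deg l u (P : M).
Proof.
move=> P0 d0_dir [_ /andP[d_dir d_lt] d_pos] u [u0 uA].
have [x [w [x0 w_dir ->]]] := rat_direction u0.
rewrite (ccwq_scale _ _ _ x0) ccwq_dirq => uB.
rewrite (deg_scalep l (dirq w) x0 P0) mulr_gt0 // -lte_fin -vdegE //.
apply: d_pos => //.
  rewrite /in_arc w_dir /ccw_lt /=; apply: contra d_lt;
    rewrite -!ccwq_dirq => le.
  by apply: ccwq_trans le _; rewrite ?ccwq_dirq ?dirq_neq0.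
by rewrite -ccwq_dirq ccwq_first ?dirq_neq0.
Qed.

Lemma l_inv_neq0 : l%:R^-1 != 0 :> K.
Proof. by rewrite invr_eq0 char0_natr_eq0 // -lt0n. Qed.

Lemma bracket_logbr0 P Q : bracket P Q = 0 -> logbr (P : M) (Q : M) = 0.
Proof.
move=> E; have := @XY_bracket K l P Q; rewrite [bracket P Q : M]E mulr0.
by move/esym/eqP; rewrite scaler_eq0 (negPf l_inv_neq0) => /eqP.
Qed.

(** Bracketing with P kills constants and P at once and Q in two steps; sums and products inherit
    nilpotency. This supplies the last nonzero G_i from which the descending induction starts. *)
Lemma subalg_nilpotent P Q G (c : K) : bracket P Q = c%:A -> subalg_gen P Q G ->
  exists k, iter k (fun H => bracket H P) G = 0.
Proof.
move=> PQ; pose br (H : M) : M := bracket (H : laurent K l) P.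
have brE (H : M) : XY M l * br H = l%:R^-1 *: logbr H (P : M).
  exact: XY_bracket.
have brc (a : K) : br a%:A = 0 := br_scalar l_gt0 brE a.
have QP : br Q = (- c)%:A.
  rewrite scaleNr -[c%:A]PQ /br /bracket.
  by rewrite opprB.
elim=> [a|||H1 H2 _ IH1 _ IH2|H1 H2 _ IH1 _ IH2].
- by exists 1%N; exact: brc.
- by exists 1%N; exact: (br_self l_gt0 brE).
- by exists 2; rewrite /= [bracket Q P]QP; exact: brc.
- exact: (@nilD _ br (br_add l_gt0 brE)).
- exact: (@nilM _ br (br_add l_gt0 brE) (br_mul l_gt0 brE)).
Qed.

End BridgeHyps.

Lemma closed_rootK (K : closedFieldType) (k : nat) (c : K) :
  (0 < k)%N -> exists z : K, z ^+ k = c.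
Proof.
move=> k0; have [z zE] :=
  solve_monicpoly (fun i => if i == 0%N then c else 0) k0.
exists z; rewrite zE; case: k k0 {zE} => // k _.
by rewrite big_ord_recl /= expr0 mulr1 big1 ?addr0 // => i _; rewrite mul0r.
Qed.

Theorem corollary7p2
  (K : closedFieldType) (charK : [pchar K] =i pred0)
  (l : nat) (l_gt0 : (0 < l)%N)
  (m n : nat) (m_gt1 : (1 < m)%N) (n_gt1 : (1 < n)%N) (mn_cop : coprime m n)
  (P Q : laurent K l)
  (brPQ : exists2 c : K, c != 0 & bracket P Q = c%:A)
  (ratio11 : (vdeg (1, 1)%R P / vdeg (1, 1)%R Q)%E = (m%:R / n%:R)%:E)
  (ratio10 : (vdeg (1, 0)%R P / vdeg (1, 0)%R Q)%E = (m%:R / n%:R)%:E)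
  (d0 : int * int) (d0_dir : is_dir d0) (d0_ge0 : 0 <= d0.1 + d0.2)
  (* (1) *)
  (d0_Dir : Dir P d0) (d0_val : (0 < vdeg d0 P)%E)
  (* (2) *)
  (eP eQ : rat * rat) (enP : is_en d0 P eP) (enQ : is_en d0 Q eQ)
  (a : int) (b : nat) (b_gt0 : (0 < b)%N)
  (eP_ab : (eP.1 / m%:R, eP.2 / m%:R) = (a%:~R / l%:R, b%:R))
  (eQ_ab : (eQ.1 / n%:R, eQ.2 / n%:R) = (a%:~R / l%:R, b%:R))
  (* (3) *)
  (ba : a%:~R / l%:R < b%:R :> rat)
  (dt : int * int) (dt_max : is_max_pos_dir d0 P dt)
  (F G0 : laurent K l) (F_hom : homogeneous d0 F)
  (G0_sub : subalg_gen P Q G0) (G0_neq0 : G0 != 0)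
  (F_val : vdeg d0 F = (d0.1 + d0.2)%:~R%:E)
  (brFP : bracket F (lead d0 P) = lead d0 P)
  (brGP : bracket (lead d0 G0) (lead d0 P) * F = lead d0 G0 * lead d0 P)
  (brGiP : forall i : nat, (1 <= i)%N ->
     bracket (lead d0 (iter i (fun G => bracket G P) G0)) (lead d0 P) = 0)
  (p q : nat) (p_gt0 : (0 < p)%N) (q_gt0 : (0 < q)%N) (pq_cop : coprime p q)
  (eF : rat * rat) (enF : is_en d0 F eF)
  (eF_ab : eF = (p%:R / q%:R * (a%:~R / l%:R), p%:R / q%:R * b%:R)) :
  forall d : int * int, is_dir d -> ccw_lt d0 d0 d -> ccw_le d0 d dt ->
    exists R : laurent K l, homogeneous d R /\ lead d P = R ^+ (q * m).
Proof.
move=> d d_dir d0d ddt; have [c c0 PQ] := brPQ.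
have m0 := ltnW m_gt1; have n0 := ltnW n_gt1.
have mR : 0 < m%:R :> rat by rewrite ltr0n.
have nR : 0 < n%:R :> rat by rewrite ltr0n.
have pR : 0 < p%:R :> rat by rewrite ltr0n.
have qR : 0 < q%:R :> rat by rewrite ltr0n.
have pqR := divr_gt0 pR qR.
pose M := laurentM K l; pose br (H : M) : M := bracket (H : laurent K l) P.
have brE (H : M) : XY M l * br H = l%:R^-1 *: logbr H (P : M) := XY_bracket H P.
have [P0 enP' [eP0 eP0P ePE]] := is_en_at enP.
have [Q0 enQ' _] := is_en_at enQ.
have [F0 enF' _] := is_en_at enF.
rewrite (eq_scalep (lt0r_neq0 mR) eP_ab) in enP' ePE.
rewrite (eq_scalep (lt0r_neq0 nR) eQ_ab) in enQ'.
rewrite eF_ab in enF'.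
have dA0 := dirq_neq0 d0_dir.
have dF := deg_vdeg F0 F_val.
have sumA : (d0.1 + d0.2)%:~R =
  (dirq d0).1 + (dirq d0).2 :> rat by rewrite rmorphD.
rewrite sumA in dF.
have [dt_pos _] := dt_max; have [_ /andP[_ dt_lt] _] := dt_pos.
have B_lt : ~~ ccwq (dirq d0) (0, -1) (dirq dt).
  by rewrite -[(0, -1)]/(dirq (0, -1)) ccwq_dirq.
have arcd : dir_arc (dirq d0) (dirq dt) (dirq d).
  by split; rewrite ?dirq_neq0 ?ccwq_dirq.
have posA : 0 < deg l (dirq d0) (P : M) by rewrite -lte_fin -vdegE.
have A_gt0 := en_at_sum_gt0 dA0 P0 F0 mR pqR enP' enF' posA dF.
have supP u : m%:R * dot u (a%:~R / l%:R, b%:R) <= deg l u (P : M).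
  have := weight_le_deg l u eP0P; rewrite /weight -ePE.
  by rewrite (dot_scalep u m%:R).
have brQ : br Q = (- c)%:A.
  by rewrite scaleNr -[c%:A]PQ /br /bracket opprB.
have Nc0 : - c != 0 by rewrite oppr_eq0.
have brQ0 : br Q != 0 by rewrite brQ scaler_eq0 negb_or Nc0 oner_neq0.
have dbrQ u : deg l u (br Q) = 0 by rewrite brQ (degZ l u _ Nc0); exact: deg1.
have hF : ldf l (dirq d0) (F : M) = F :=
  etrans (esym (leadE d0 F)) (esym F_hom).
have brG := brGP; rewrite !leadE in brG.
have brGi i : (0 < i)%N ->
    logbr (ldf l (dirq d0) (iter i br (G0 : M))) (ldf l (dirq d0) (P : M)) = 0.
  by move=> /brGiP; rewrite !leadE => /(bracket_logbr0 l_gt0 charK).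
have [R hR PR] := leading_form_power l_gt0 charK (@closed_rootK K) A_gt0 B_lt
  P0 Q0 F0 G0_neq0 posA (dir_arc_deg_gt0 P0 d0_dir dt_pos) m0 n0 p_gt0 q_gt0
  mn_cop pq_cop enP' enQ' enF' supP ba (l_inv_neq0 l_gt0 charK) brE brQ0 dbrQ
  hF dF (bracket_mul brG) brGi (subalg_nilpotent l_gt0 PQ G0_sub) arcd.
exists R; split; first exact: etrans (esym hR) (esym (leadE d R)).
exact: etrans (leadE d P) PR.
Qed.
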